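(* Let $n\ge 2$ and let $K \subseteq \mathbb{S}^n$ be a spherically convex body which is centrally-symmetric with center $e \in \mathbb{S}^n$. If $U_1, U_2, \ldots$ are independent random unit vectors distributed uniformly in $K$, then \[\Gamma_{s,e}(U_1,\ldots,U_N) \to \Gamma_s K\] almost surely in the spherical Hausdorff metric $\delta_s$ as $N\to\infty$.
   Context: $\mathbb{S}^n$ is the Euclidean unit sphere of $\mathbb{R}^{n+1}$, $n\ge 2$, and $\sigma$ is spherical Lebesgue measure on it. For $u\in\mathbb{S}^n$ let $\mathbb{S}_u^+=\{v\in\mathbb{S}^n: u\cdot v\ge 0\}$ and $\mathbb{S}_u=\mathbb{S}^n\cap u^\perp$. Interior and boundary of subsets of $\mathbb{S}^n$ are relative to $\mathbb{S}^n$. A set $A\subseteq\mathbb{S}^n$ is (spherically) convex if $\{\lambda u:\lambda\ge 0,u\in A\}$ is convex in $\mathbb{R}^{n+1}$; $\mathrm{conv}\,A$ is the intersection of all convex subsets of $\mathbb{S}^n$ containing $A$. A (spherically) convex body is a closed convex set $K\subseteq \mathbb{S}^n$, $K\neq\mathbb{S}^n$, with nonempty interior; it is proper if it is contained in some open hemisphere. For $e,v\in\mathbb{S}^n$ put $v^e=-v+2(v\cdot e)e$ (geodesic reflection of $v$ about $e$). $K$ is centrally-symmetric with center $e$ if $K^e=\{v^e: v\in K\}=K$; the center is taken so that $K\subseteq\mathbb{S}_e^+$. Spherical centroids: $c_s(u_1,\ldots,u_N)=\frac{\sum_i u_i}{\|\sum_i u_i\|}$ for points $u_i\in\mathbb{S}^n$,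 and $c_s(A)=\frac{\int_A u\,d\sigma(u)}{\|\int_A u\,d\sigma(u)\|}$ for Borel $A\subseteq\mathbb{S}^n$ with $\sigma(A)>0$, whenever the denominators are nonzero. The spherical centroid body $\Gamma_sK$ of a centrally-symmetric convex body $K$ with center $e$ is the proper spherically convex body with boundary $\mathrm{bd}\,\Gamma_sK=\{c_s(K\cap\mathbb{S}_u^+):u\in\mathbb{S}_e\}$ (this is well defined). For $u_1,\ldots,u_N\in\mathrm{int}\,\mathbb{S}_e^+$, $\Gamma_{s,e}(u_1,\ldots,u_N)=\mathrm{conv}\{c_s(v_1,\ldots,v_N): v_i\in\{u_i,u_i^e\},\ 1\le i\le N\}$. ''Distributed uniformly in $K$'' means with law $\sigma(\cdot\cap K)/\sigma(K)$; then almost surely all $U_i\in\mathrm{int}\,\mathbb{S}_e^+$. The spherical Hausdorff metric on closed sets is $\delta_s(A,B)=\min\{0\le r\le\pi: A\subseteq B_r,\ B\subseteq A_r\}$, where $A_r$ is the set of points at spherical distance ($d_s(u,v)=\arccos(u\cdot v)$) at most $r$ from $A$. *)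

(* Defs.v *)
From HB Require Import structures.
From mathcomp Require Import all_boot all_order all_algebra finmap.
From mathcomp Require Import all_classical all_reals all_analysis measurable_realfun.

Set Implicit Arguments.
Unset Strict Implicit.
Unset Printing Implicit Defensive.
Import Order.TTheory GRing.Theory Num.Theory.
Import numFieldNormedType.Exports.
Local Open Scope classical_set_scope.
Local Open Scope ring_scope.

(* The sigma-algebra of ['rV[R]_n] is generated by the coordinate maps, i.e.
   it is the Borel sigma-algebra of R^n, as for [n.-tuple R] in the library. *)

Definition measure_rV_display : measure_display.
Proof. exact: (measure_tuple_display default_measure_display). Qed.

Section measurable_rV.
Context {R : realType} (n : nat).

Let coors : 'I_n -> 'rV[R]_n -> measurableTypeR R := fun i x => x 0 i.

Let rV_set0 : g_sigma_preimage coors set0.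
Proof. exact: sigma_algebra0. Qed.

Let rV_setC A : g_sigma_preimage coors A -> g_sigma_preimage coors (~` A).
Proof. exact: sigma_algebraC. Qed.

Let rV_bigcup (F : (set 'rV[R]_n)^nat) :
  (forall i, g_sigma_preimage coors (F i)) ->
  g_sigma_preimage coors (\bigcup_i (F i)).
Proof. exact: sigma_algebra_bigcup. Qed.

HB.instance Definition _ := @isMeasurable.Build measure_rV_display
  'rV[R]_n (g_sigma_preimage coors) rV_set0 rV_setC rV_bigcup.

Lemma measurable_coord (i : 'I_n) :
  measurable_fun [set: 'rV[R]_n] (fun x : 'rV[R]_n => x 0 i).
Proof.
move=> _ Y mY; rewrite setTI; apply: sub_sigma_algebra => /=.
rewrite -bigcup_seq/=; exists i => /=; first by rewrite mem_index_enum.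
by exists Y => //; rewrite setTI.
Qed.

Lemma measurable_fun_rVP d (T : measurableType d) (f : T -> 'rV[R]_n) :
  measurable_fun [set: T] f <->
  forall i, measurable_fun [set: T] (fun x => f x 0 i).
Proof.
split=> [mf i|mf].
  exact: (measurableT_comp (measurable_coord i) mf).
move=> _ A mA; rewrite setTI.
suff : g_sigma_preimage coors `<=` [set B | measurable (f @^-1` B)] by exact.
apply: smallest_sub.
  split => /=.
  - by rewrite preimage_set0; exact: measurable0.
  - by move=> B mB; rewrite setTD preimage_setC; exact: measurableC.
  - by move=> F mF; rewrite preimage_bigcup; exact: bigcup_measurable.
rewrite -bigcup_seq; apply: bigcup_sub => i _ B [C mC <-] /=.
by rewrite setTI -comp_preimage -[X in measurable X]setTI; exact: mf.
Qed.

End measurable_rV.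

Section lebesgue_rV.
Context {R : realType}.
Local Open Scope ereal_scope.

Definition rV_cons n (p : measurableTypeR R * 'rV[R]_n) : 'rV[R]_n.+1 :=
  \row_(i < n.+1) if unlift ord0 i is Some j then p.2 0%R j else p.1.

Definition rV_uncons n (v : 'rV[R]_n.+1) : measurableTypeR R * 'rV[R]_n :=
  (v 0%R ord0, \row_(i < n) v 0%R (lift ord0 i)).

Lemma rV_consK n : cancel (@rV_cons n) (@rV_uncons n).
Proof.
move=> [x v]; rewrite /rV_cons /rV_uncons /= mxE unlift_none; congr (_, _).
by apply/rowP => i; rewrite !mxE liftK.
Qed.

Lemma rV_unconsK n : cancel (@rV_uncons n) (@rV_cons n).
Proof.
move=> v; apply/rowP => i; rewrite /rV_cons /rV_uncons mxE /=.
by case: unliftP => [j ->|->]//; rewrite mxE.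
Qed.

Lemma measurable_rV_cons n : measurable_fun setT (@rV_cons n).
Proof.
apply/measurable_fun_rVP => i; rewrite /rV_cons.
under eq_fun do rewrite mxE.
case: unliftP => [j _|_]; last exact: measurable_fst.
exact: (measurableT_comp (measurable_coord j) measurable_snd).
Qed.

Lemma measurable_rV_uncons n : measurable_fun setT (@rV_uncons n).
Proof.
apply: measurable_fun_pair => /=; first exact: (measurable_coord ord0).
apply/measurable_fun_rVP => i.
rewrite (_ : (fun x => _) = fun v : 'rV[R]_n.+1 => v 0%R (lift ord0 i)).
  exact: measurable_coord.
by apply/funext => v; rewrite /= mxE.
Qed.

Section step.
Variables (n : nat) (mu : {sigma_finite_measure set 'rV[R]_n -> \bar R}).

Definition lebesgue_rV_step : set 'rV[R]_n.+1 -> \bar R :=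
  pushforward (@lebesgue_measure R \x mu) (@rV_cons n).

Let step0 : lebesgue_rV_step set0 = 0.
Proof. by rewrite /lebesgue_rV_step /pushforward preimage_set0 measure0. Qed.

Let step_ge0 A : 0 <= lebesgue_rV_step A.
Proof. by rewrite /lebesgue_rV_step /pushforward; exact: measure_ge0. Qed.

Let step_sigma_additive : semi_sigma_additive lebesgue_rV_step.
Proof.
have mcons := @measurable_rV_cons n.
by apply: (@measure_semi_sigma_additive _ _ _ (pushforward (@lebesgue_measure R \x mu) (@rV_cons n))).
Qed.

HB.instance Definition _ := isMeasure.Build _ _ _ lebesgue_rV_step
  step0 step_ge0 step_sigma_additive.

Let step_sigma_finite : sigma_finite setT lebesgue_rV_step.
Proof.
have /sigma_finiteP[F [TF ndF Foo]] := sigma_finiteT (@lebesgue_measure R).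
have /sigma_finiteP[G [TG ndG Goo]] := sigma_finiteT mu.
exists (fun k => @rV_uncons n @^-1` (F k `*` G k)).
  rewrite -preimage_bigcup -(preimage_setT (@rV_uncons n)); congr (_ @^-1` _).
  rewrite -setXTT TF TG predeqE => -[x y]; split.
    move=> [/= [i _ Fx] [k _ Gy]]; exists (maxn i k) => //; split.
    - by move: x Fx; exact/subsetPset/ndF/leq_maxl.
    - by move: y Gy; exact/subsetPset/ndG/leq_maxr.
  by move=> [i _ []/= ? ?]; split; exists i.
move=> k; have [mF Fk] := Foo k; have [mG Gk] := Goo k; split.
  rewrite -[X in measurable X]setTI; apply: measurable_rV_uncons => //.
  exact: measurableX.
rewrite /lebesgue_rV_step /pushforward -comp_preimage.
rewrite (_ : _ \o _ = id); last by apply/funext => p; exact: rV_consK.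
rewrite preimage_id product_measure1E//.
by rewrite lte_mul_pinfty// ge0_fin_numE.
Qed.

HB.instance Definition _ := Measure_isSigmaFinite.Build _ _ _ lebesgue_rV_step
  step_sigma_finite.

End step.

(* [\d_0] on the one-point space R^0 is its 0-dimensional volume. *)
Fixpoint lebesgue_rV (n : nat) : {sigma_finite_measure set 'rV[R]_n -> \bar R} :=
  match n with
  | 0%N => \d_(0%R : 'rV[R]_0)
  | m.+1 => lebesgue_rV_step (lebesgue_rV m)
  end.

End lebesgue_rV.
Arguments lebesgue_rV {R} n.

Section sphere.
Context {R : realType}.

(* The library's norm on ['rV[R]_n] is the sup norm, hence the Euclidean one
   is defined here; both induce the same topology. *)
Definition dotv m (u v : 'rV[R]_m) : R := \sum_(i < m) u 0 i * v 0 i.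
Definition enorm m (v : 'rV[R]_m) : R := Num.sqrt (dotv v v).
Definition normalize m (v : 'rV[R]_m) : 'rV[R]_m := (enorm v)^-1 *: v.

Arguments normalize {m} v.

Lemma dotv_ge0 m (v : 'rV[R]_m) : 0 <= dotv v v.
Proof. by apply: sumr_ge0 => i _; rewrite -expr2 sqr_ge0. Qed.

Lemma measurable_enorm m : measurable_fun setT (@enorm m).
Proof.
rewrite (_ : @enorm m = (@powR R ^~ 2^-1) \o (fun v => dotv v v)).
  apply: measurableT_comp; first exact: measurable_powR.
  by apply: measurable_sum => i; apply: measurable_funM; exact: measurable_coord.
by apply/funext => v; rewrite /= powR12_sqrt// dotv_ge0.
Qed.

Lemma measurable_normalize m : measurable_fun setT (@normalize m).
Proof.
apply/measurable_fun_rVP => i.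
rewrite (_ : (fun v => _) =
  ((@powR R ^~ (-1)) \o @enorm m) \* (fun v : 'rV[R]_m => v 0 i)).
  apply: measurable_funM; last exact: measurable_coord.
  apply: measurableT_comp; first exact: measurable_powR.
  exact: measurable_enorm.
by apply/funext => v; rewrite mxE /= powR_inv1// sqrtr_ge0.
Qed.

Lemma measurable_eball m : measurable [set v : 'rV[R]_m | enorm v <= 1].
Proof.
rewrite -[X in measurable X]setTI.
exact: (measurable_enorm measurableT (measurable_itv `]-oo, 1%R])).
Qed.

Section dimension.
Variable n : nat.
Local Notation V := 'rV[R]_n.+1.
Implicit Types (A B C K : set V) (e u v : V).

Definition sphere : set V := [set v | enorm v = 1].
Definition hemisphere u : set V := [set v | sphere v /\ 0 <= dotv u v].
Definition open_hemisphere u : set V := [set v | sphere v /\ 0 < dotv u v].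
Definition great_subsphere u : set V := [set v | sphere v /\ dotv u v = 0].

(* Interior and boundary relative to the sphere. *)
Definition sinterior A : set V := @interior (subspace sphere) A.
Definition sboundary A : set V :=
  @closure (subspace sphere) A `\` @interior (subspace sphere) A.

Definition cone A : set V :=
  [set l *: u | l in [set l : R | 0 <= l] & u in A].
Definition sconvex A : Prop :=
  A `<=` sphere /\ convex_set (cone A : set (convex_lmodType V)).
Definition sconv A : set V :=
  \bigcap_(C in [set C | sconvex C /\ A `<=` C]) C.

Definition convex_body K : Prop :=
  [/\ sconvex K, closed K, K <> sphere & sinterior K !=set0].
Definition proper_convex_body K : Prop :=
  convex_body K /\ exists2 u, sphere u & K `<=` open_hemisphere u.

Definition reflect_about e v : V := - v + (2 * dotv v e) *: e.

Definition centrally_symmetric K e : Prop :=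
  reflect_about e @` K = K /\ K `<=` hemisphere e.

(* Polar coordinates: [(n + 1)] times the volume of the part of the cone over
   [A] that lies in the unit ball. *)
Definition spherical_measure (A : set V) : \bar R :=
  (n.+1%:R%:E * lebesgue_rV n.+1
     (normalize @^-1` A `&` [set v : V | (enorm v <= 1)%R]))%E.

Let spherical_measure0 : spherical_measure set0 = 0%E.
Proof. by rewrite /spherical_measure preimage_set0 set0I measure0 mule0. Qed.

Let spherical_measure_ge0 A : (0 <= spherical_measure A)%E.
Proof. by rewrite /spherical_measure mule_ge0. Qed.

Let spherical_measure_sigma_additive : semi_sigma_additive spherical_measure.
Proof.
have mN := @measurable_normalize n.+1.
pose mu1 := mrestr (lebesgue_rV n.+1) (@measurable_eball n.+1).
by apply: (@measure_semi_sigma_additive _ _ _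
  (mscale n.+1%:R%:nng (pushforward mu1 (@normalize n.+1)))).
Qed.

HB.instance Definition _ := isMeasure.Build _ _ _ spherical_measure
  spherical_measure0 spherical_measure_ge0 spherical_measure_sigma_additive.

Definition centroid_points N (v : 'I_N -> V) : V := normalize (\sum_(i < N) v i).
Definition centroid A : V :=
  normalize (\row_i (\int[spherical_measure]_(u in A) (u 0 i))).

(* For [K] a centrally-symmetric convex body with center [e] this is the only
   set satisfying the defining conditions. *)
Definition centroid_body K e : set V :=
  get [set G | proper_convex_body G /\
    sboundary G =
      [set centroid (K `&` hemisphere u) | u in great_subsphere e]].

Definition discrete_centroid_body e N (u : 'I_N -> V) : set V :=
  sconv [set centroid_points v | v in
    [set v : 'I_N -> V | forall i, v i = u i \/ v i = reflect_about e (u i)]].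

Definition sdist u v : R := acos (dotv u v).

Definition sthickening A (r : R) : set V :=
  [set v | sphere v /\ (ereal_inf [set (sdist v a)%:E | a in A] <= r%:E)%E].

(* For nonempty closed subsets of the sphere the infimum is attained; it is
   [+oo] if exactly one of the sets is empty. *)
Definition shausdorff A B : \bar R :=
  ereal_inf [set r%:E | r in [set r : R | 0 <= r <= pi /\
    A `<=` sthickening B r /\ B `<=` sthickening A r]].

End dimension.
End sphere.
Arguments sphere {R} n.

Section random.
Context d d' (Omega : measurableType d) (T : measurableType d') (R : realType).
Variable P : probability Omega R.
Local Open Scope ereal_scope.

Definition mutually_independent (X : nat -> {RV P >-> T}) : Prop :=
  forall (J : {fset nat}) (B : nat -> set T), (forall j, measurable (B j)) ->
  P (\bigcap_(j in [set` J]) X j @^-1` B j) =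
  \prod_(j <- J) P (X j @^-1` B j).

End random.

Definition uniformly_distributed_in d (Omega : measurableType d) (R : realType)
    (P : probability Omega R) n (K : set 'rV[R]_n.+1)
    (X : {RV P >-> 'rV[R]_n.+1}) : Prop :=
  forall B : set 'rV[R]_n.+1, measurable B ->
    distribution P X B =
    (@spherical_measure R n (B `&` K) / spherical_measure K)%E.

(* Main.v *)
(* For [u] orthogonal to [e] let [b(u)] be the integral of [|u . x|] over [K].
   The reflection about [e] preserves the surface measure, so twice the moment
   of [K] cut by the half-space of [u] has a component along [e] which does not
   depend on [u], namely [b(e)], while its component orthogonal to [e] is the
   gradient of [b] at [u]. Hence the cone over [Gamma_s K] consists of the [x]
   with [b(e) (x . u) <= (x . e) b(u)] for all such [u]: up to scale, its
   section by a translate of the orthogonal complement of [e] is the zonoid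
   with support function [b].
   The discrete body has the same description, the sums of [|u . U_i|] and
   [e . U_i] replacing [b(u)] and [b(e)], because a point below the support
   function of a zonotope lies in it. Therefore everything reduces to a law of
   large numbers which is uniform in [u]; it is obtained for all 1-Lipschitz
   functions at once by cutting the sphere into finitely many small cells and
   using the strong law for the frequency of each cell. *)
Require Import Defs.
From HB Require Import structures.
From mathcomp Require Import all_boot all_order all_algebra finmap.
From mathcomp Require Import all_classical all_reals all_analysis measurable_realfun.
From mathcomp Require Import unstable zify ring lra.
Set Implicit Arguments.
Unset Strict Implicit.
Unset Printing Implicit Defensive.
Import Order.TTheory GRing.Theory Num.Theory.
Import numFieldNormedType.Exports.
Local Open Scope classical_set_scope.
Local Open Scope ring_scope.
Arguments normalize {R m} v.

(** The centroid body is picked by [get] from its boundary, so besides exhibiting the support body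
    one must know that a proper body is the hull of its boundary. Describing both bodies by
    homogeneous inequalities c (x . u) <= (x . e) W(u) removes every normalising factor: closeness
    in [shausdorff] follows from a two-sided comparison of W / c up to the factor cos t, because the
    gnomonic dilation by cos t moves no point farther than t. To pass from the absolute errors of a
    law of large numbers to such relative ones, [width] needs a positive lower bound on unit
    vectors; it comes from compactness and from great subspheres being null. The same nullity makes
    the support function differentiable, which identifies the boundary with the centroids. The
    exceptional null set must not depend on u; this is why the law of large numbers fixes the number
    of samples before the test function. Positivity of the total height of the samples then follows
    for large N. *)

(** * Measurability and integrals of finite sums *)

Lemma measurable_preimage d d' (T : measurableType d) (T' : measurableType d')
    (f : T -> T') (A : set T') :
  measurable_fun [set: T] f -> measurable A -> measurable (f @^-1` A).
Proof. by move=> mf mA; rewrite -[X in measurable X]setTI; exact: mf. Qed.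

(** The product measure is by definition the integral of the measures of the sections. *)
Lemma product_measure_null1 d1 d2 (T1 : measurableType d1)
    (T2 : measurableType d2) (R : realType)
    (m1 : {measure set T1 -> \bar R}) (m2 : {measure set T2 -> \bar R})
    (A : set (T1 * T2)) :
  (forall x, m2 (xsection A x) = 0%E) -> (m1 \x m2)%E A = 0%E.
Proof. by move=> A0; apply: integral0_eq => x _ /=. Qed.

Section Rintegral_sum.
Context d (T : measurableType d) (R : realType).
Variables (mu : {measure set T -> \bar R}) (D : set T) (I : Type).
Variable f : I -> T -> R.
Hypotheses (mD : measurable D) (fi : forall i, mu.-integrable D (EFin \o f i)).

Lemma integrable_Rsum (s : seq I) :
  mu.-integrable D (EFin \o (fun x => \sum_(i <- s) f i x)).
Proof.
elim: s => [|i s IH].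
  have := integrable0 mu D; congr (_.-integrable _ _).
  by apply/funext => x /=; rewrite big_nil.
have := integrableD mD (fi i) IH; congr (_.-integrable _ _).
by apply/funext => x /=; rewrite big_cons.
Qed.

Lemma Rintegral_sum (s : seq I) :
  Rintegral mu D (fun x => \sum_(i <- s) f i x) = \sum_(i <- s) Rintegral mu D (f i).
Proof.
elim: s => [|i s IH].
  rewrite big_nil -[RHS](mul0r (fine (mu D))) -Rintegral_cst//.
  by apply: eq_Rintegral => x _; rewrite big_nil.
rewrite big_cons -IH -RintegralD//; last exact: integrable_Rsum.
by apply: eq_Rintegral => x _; rewrite big_cons.
Qed.

End Rintegral_sum.

(** * Lebesgue measure on row vectors *)

Section lebesgue_rV_theory.
Context {R : realType}.

Lemma lebesgue_measure_shift (a : R) (A : set (measurableTypeR R)) :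
  measurable A ->
  lebesgue_measure ((fun x : measurableTypeR R =>
    (x + a : measurableTypeR R)) @^-1` A) = lebesgue_measure A.
Proof.
move=> mA.
have mf : measurable_fun [set: measurableTypeR R]
    (fun x : measurableTypeR R => (x + a : measurableTypeR R)).
  by apply: measurable_funD; [exact: measurable_id|exact: measurable_cst].
apply/esym/(lebesgue_measure_unique (mu := pushforward lebesgue_measure
   (fun x : measurableTypeR R => (x + a : measurableTypeR R)))) => // X [[p q] _ <-].
rewrite /= /pushforward (_ : _ @^-1` _ = `](p - a), (q - a)]%classic).
  rewrite !lebesgue_measure_itv/= !lte_fin ltrBDr subrK.
  by case: ifP => // _; rewrite -!EFinB; congr EFin; ring.
by apply/seteqP; split => x /=; rewrite !in_itv/= ltrBlDr lerBrDr.
Qed.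

Lemma measurable_rV_shift n (a : 'rV[R]_n) :
  measurable_fun [set: 'rV[R]_n] (fun v => v + a).
Proof.
apply/measurable_fun_rVP => i; under eq_fun do rewrite mxE.
by apply: measurable_funD; [exact: measurable_coord|exact: measurable_cst].
Qed.

Lemma lebesgue_rVS n (A : set 'rV[R]_n.+1) :
  lebesgue_rV n.+1 A = (@lebesgue_measure R \x lebesgue_rV n)%E (@rV_cons R n @^-1` A).
Proof. by []. Qed.

(** By induction on the dimension: through [rV_cons] the shift is a product of two shifts, and a
    measure that agrees with the product measure on rectangles equals it. *)
Lemma lebesgue_rV_shift n (a : 'rV[R]_n) (A : set 'rV[R]_n) : measurable A ->
  lebesgue_rV n ((fun v => v + a) @^-1` A) = lebesgue_rV n A.
Proof.
elim: n a A => [|n IH] a A mA.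
  by congr (lebesgue_rV 0 _); apply/seteqP; split => x /=; rewrite (_ : x + a = x)//;
    apply/rowP => -[].
rewrite !lebesgue_rVS.
pose a0 : R := a 0 ord0; pose a' : 'rV[R]_n := \row_(i < n) a 0 (lift ord0 i).
pose s (p : measurableTypeR R * 'rV[R]_n) : measurableTypeR R * 'rV[R]_n :=
  (p.1 + a0, p.2 + a').
have ms : measurable_fun setT s.
  apply: measurable_fun_pair => /=.
    by apply: measurable_funD; [exact: measurable_fst|exact: measurable_cst].
  exact: (measurableT_comp (measurable_rV_shift a') measurable_snd).
rewrite (_ : _ @^-1` _ = s @^-1` (@rV_cons R n @^-1` A)); last first.
  apply/seteqP; split => -[x v] /=; rewrite (_ : rV_cons (x, v) + a = rV_cons (s (x, v)))//;
   by apply/rowP => i; rewrite !mxE; case: unliftP => [j ->|->]; rewrite ?mxE.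
apply/esym.
apply: (@product_measure_unique _ _ _ _ _ _ _
  (pushforward (@lebesgue_measure R \x lebesgue_rV n)%E s)).
  move=> X Y mX mY; rewrite /= /pushforward.
  rewrite (_ : s @^-1` _ = ((fun x : measurableTypeR R => (x + a0 : measurableTypeR R)) @^-1` X)
     `*` ((fun v => v + a') @^-1` Y))//.
  rewrite product_measure1E; first by congr (_ * _)%E; [exact: lebesgue_measure_shift|exact: IH].
    apply: measurable_preimage => //.
    by apply: measurable_funD; [exact: measurable_id|exact: measurable_cst].
  exact: measurable_preimage (measurable_rV_shift a') _.
exact: measurable_preimage (@measurable_rV_cons R n) _.
Qed.


(** [\x^] integrates the sections in the other order and has the same values on rectangles, hence
    equals [\x]. *)
Lemma product_measure_swap d1 d2 (T1 : measurableType d1)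
    (T2 : measurableType d2)
    (m1 : {sigma_finite_measure set T1 -> \bar R})
    (m2 : {sigma_finite_measure set T2 -> \bar R}) (E : set (T1 * T2)) :
  measurable E ->
  (\int[m1]_x m2 (xsection E x) = \int[m2]_y m1 (ysection E y))%E.
Proof.
move=> mE.
apply: (@product_measure_unique _ _ _ _ _ m1 m2 (m1 \x^ m2)%E _ E mE).
by move=> A B mA mB; exact: product_measure2E.
Qed.

(* Fubini's uniqueness argument for Haar measure: both integrals below compute
   the mass of {(x, y) | T x + y \in A, y \in B}. *)
Lemma lebesgue_rV_involution n (T : 'rV[R]_n -> 'rV[R]_n) (A B : set 'rV[R]_n) :
  measurable_fun setT T -> {morph T : x y / x + y} -> involutive T ->
  measurable A -> measurable B -> T @^-1` B = B ->
  (fun v => - v) @^-1` B = B ->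
  (0 < lebesgue_rV n B < +oo)%E ->
  lebesgue_rV n (T @^-1` A) = lebesgue_rV n A.
Proof.
move=> mT Tadd TT mA mB TB NB /andP[B0 Boo].
pose lam := @lebesgue_rV R n.
have measTD : measurable_fun setT (fun p : 'rV[R]_n * 'rV[R]_n => T p.1 + p.2).
  apply/measurable_fun_rVP => i; under eq_fun do rewrite mxE.
  apply: measurable_funD.
    exact: (measurableT_comp (measurable_coord i) (measurableT_comp mT measurable_fst)).
  exact: (measurableT_comp (measurable_coord i) measurable_snd).
have measTB : measurable_fun setT (fun p : 'rV[R]_n * 'rV[R]_n => p.2 - T p.1).
  apply/measurable_fun_rVP => i; under eq_fun do rewrite !mxE.
  apply: measurable_funB.
    exact: (measurableT_comp (measurable_coord i) measurable_snd).
  exact: (measurableT_comp (measurable_coord i) (measurableT_comp mT measurable_fst)).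
(* [E2] is the image of [E1] under the shear y |-> y + T x, which keeps the measure of the sections
   at fixed x. At fixed y, the sections of [E1] over [B] are translates of the preimage of [A],
   those of [E2] over [A] are translates of [B]. *)
pose E1 := (fun p : 'rV[R]_n * 'rV[R]_n => T p.1 + p.2) @^-1` A `&` (snd @^-1` B).
pose E2 := (fun p : 'rV[R]_n * 'rV[R]_n => p.2 - T p.1) @^-1` B `&` (snd @^-1` A).
have mE1 : measurable E1.
  by apply: measurableI; apply: measurable_preimage => //; exact: measurable_snd.
have mE2 : measurable E2.
  by apply: measurableI; apply: measurable_preimage => //; exact: measurable_snd.
have int_ind (C D : set 'rV[R]_n) : measurable D ->
   (\int[lam]_y (lam C * (\1_D y)%:E) = lam C * lam D)%E.
  move=> mD; rewrite ge0_integralZl//; last exact: measurableT_comp.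
  by rewrite integral_indic// setIT.
have mTA : measurable (T @^-1` A) by exact: measurable_preimage.
have H1 : (\int[lam]_y lam (ysection E1 y) = lam (T @^-1` A) * lam B)%E.
  rewrite -int_ind//; apply: eq_integral => y _; rewrite indicE ysectionE /E1.
  case: (boolP (y \in B)) => yB; last first.
    rewrite mule0 (_ : _ @^-1` _ = set0) ?measure0//.
    by apply/seteqP; split => x //= [_ /mem_set]; rewrite (negPf yB).
  rewrite mule1 /lam -(lebesgue_rV_shift (T y) mTA); congr (lebesgue_rV n _).
  apply/seteqP; split => x /=; rewrite Tadd TT; first by case.
  by move=> ?; split => //; exact: set_mem.
have H2 : (\int[lam]_y lam (ysection E2 y) = lam B * lam A)%E.
  rewrite -int_ind//; apply: eq_integral => y _; rewrite indicE ysectionE /E2.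
  case: (boolP (y \in A)) => yA; last first.
    rewrite mule0 (_ : _ @^-1` _ = set0) ?measure0//.
    by apply/seteqP; split => x //= [_ /mem_set]; rewrite (negPf yA).
  rewrite mule1 /lam -(lebesgue_rV_shift (- T y) mB); congr (lebesgue_rV n _).
  have BE x : B (y - T x) = B (x - T y).
    rewrite -[in LHS]TB -[in LHS]NB /= (_ : - T (y - T x) = x - T y)//.
    have T0 : T 0 = 0 by apply: (addrI (T 0)); rewrite -Tadd !addr0.
    have TN z : T (- z) = - T z.
      by apply/eqP; rewrite -subr_eq0 opprK -Tadd addNr T0.
    by rewrite Tadd TN TT opprD opprK addrC.
  apply/seteqP; split => x /=; rewrite -BE; first by case.
  by move=> ?; split => //; exact: set_mem.
have H3 : (\int[lam]_x lam (xsection E1 x) = \int[lam]_x lam (xsection E2 x))%E.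
  apply: eq_integral => x _; rewrite !xsectionE /lam.
  rewrite -[RHS](lebesgue_rV_shift (T x)); last first.
    rewrite -xsectionE; exact: measurable_xsection.
  congr (lebesgue_rV n _).
  by apply/seteqP; split => y; rewrite /E1 /E2 /= addrK (addrC (T x)) => -[].
have := H1; rewrite -product_measure_swap// H3 product_measure_swap// H2.
have Bfin : lam B \is a fin_num by rewrite ge0_fin_numE.
move=> /esym/eqP; rewrite (muleC (lam B)) => /eqP.
move: B0 Bfin; rewrite -/(lam B); case: (lam B) => // r r0 _.
move=> /(congr1 (fun z => z * (r^-1)%:E)%E).
rewrite -!muleA -!EFinM divff ?mule1//.
by rewrite gt_eqF// -lte_fin.
Qed.

Lemma dotv_cons n (a : 'rV[R]_n.+1) x (v : 'rV[R]_n) :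
  dotv a (rV_cons (x, v)) = a 0 ord0 * x + dotv (\row_j a 0 (lift ord0 j)) v.
Proof.
rewrite /dotv big_ord_recl !mxE unlift_none; congr (_ + _).
by apply: eq_bigr => i _; rewrite !mxE liftK.
Qed.

Lemma measurable_dotv n (u : 'rV[R]_n) : measurable_fun setT (dotv u).
Proof.
apply: measurable_sum => i; apply: measurable_funM; first exact: measurable_cst.
exact: measurable_coord.
Qed.

(** Induction on the dimension, for every level [c]. If some coefficient other than the first is
    nonzero, each section is a hyperplane at another level; otherwise the set is one point times the
    whole space. *)
Lemma lebesgue_rV_hyperplane n (a : 'rV[R]_n) c : a != 0 ->
  lebesgue_rV n [set v | dotv a v = c] = 0%E.
Proof.
elim: n a c => [|n IH] a c a0.
  by case/negP: a0; apply/eqP/rowP => -[].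
rewrite lebesgue_rVS.
pose a' := \row_j a 0 (lift ord0 j).
have [a'0|a'0] := eqVneq a' 0; last first.
  apply: product_measure_null1 => x; rewrite -(IH a' (c - a 0 ord0 * x) a'0).
  congr (lebesgue_rV n _); rewrite xsectionE.
  by apply/seteqP; split => v /=; rewrite dotv_cons -/a'; lra.
have a00 : a 0 ord0 != 0.
  apply: contra_neq a0 => a00; apply/rowP => i.
  rewrite mxE; case: (unliftP ord0 i) => [j ->|->//].
  by move/rowP : a'0 => /(_ j); rewrite !mxE.
rewrite (_ : _ @^-1` _ = [set c / a 0 ord0] `*` setT).
  by rewrite product_measure1E// [X in (X * _)%E]lebesgue_measure_set1 mul0e.
have d0 v : dotv a' v = 0.
  by rewrite a'0 /dotv big1// => i _; rewrite mxE mul0r.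
apply/seteqP; split => -[x v] /=; rewrite dotv_cons -/a' d0 addr0.
  by move=> <-; rewrite mulrAC divff// mul1r.
by case=> -> _; rewrite mulrCA divff// mulr1.
Qed.

Lemma lebesgue_rV_box n (p : 'rV[R]_n) r : 0 < r ->
  lebesgue_rV n [set v | forall i, ball (p 0 i) r (v 0 i)] = ((r *+ 2) ^+ n)%:E.
Proof.
move=> r0; elim: n p => [|n IH] p.
  rewrite (_ : [set _ | _] = setT); last by apply/seteqP; split => // x _ [].
  by rewrite expr0 /= diracT.
rewrite lebesgue_rVS (_ : _ @^-1` _ = (ball (p 0 ord0) r : set (measurableTypeR R)) `*`
  [set v : 'rV[R]_n | forall i, ball ((\row_j p 0 (lift ord0 j)) 0 i) r (v 0 i)]).
  rewrite product_measure1E; last 2 first.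
  - exact: measurable_ball.
  - rewrite (_ : [set _ | _] = \bigcap_(i in [set: 'I_n])
      ((fun v : 'rV[R]_n => v 0 i) @^-1` ball ((\row_j p 0 (lift ord0 j)) 0 i) r)).
      apply: fin_bigcap_measurable => // i _.
      apply: measurable_preimage; [exact: measurable_coord|exact: measurable_ball].
    by apply/seteqP; split => v /= H i; [move=> _; exact: H|exact: H].
  rewrite exprS EFinM; congr (_ * _)%E; last exact: IH.
  by apply: lebesgue_measure_ball; exact: ltW.
apply/seteqP; split => -[x v] /= => [H|[H1 H2] i].
  split; first by have := H ord0; rewrite mxE unlift_none.
  by move=> i; have := H (lift ord0 i); rewrite !mxE liftK.
by rewrite mxE; case: unliftP => [j ->|->//]; have := H2 j; rewrite mxE.
Qed.

End lebesgue_rV_theory.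

(** * Euclidean structure of row vectors *)

Lemma continuous_sum (R : realType) (T : topologicalType) I (s : seq I)
    (f : I -> T -> R) : (forall i, continuous (f i)) ->
  continuous (fun x => \sum_(i <- s) f i x).
Proof.
move=> cf; elim: s => [|i s IH] x.
  by under eq_fun do rewrite big_nil; exact: cst_continuous.
under eq_fun do rewrite big_cons.
by apply: continuousD; [exact: cf|exact: IH].
Qed.

Lemma ltr_distm_half (R : realType) (c t q v w : R) :
  c < t / 2 -> `|q - w| < c -> `|q - v| < c -> `|w - v| < t.
Proof.
by move=> ct; rewrite !ltr_norml => /andP[? ?] /andP[? ?]; apply/andP; split; lra.
Qed.

Section dot_product.
Context {R : realType} (m : nat).
Local Notation V := 'rV[R]_m.
Implicit Types (u v w x y e : V) (a : R).

Lemma dotvC u v : dotv u v = dotv v u.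
Proof. by apply: eq_bigr => i _; rewrite mulrC. Qed.

Lemma dotvDr u v w : dotv u (v + w) = dotv u v + dotv u w.
Proof.
by rewrite /dotv -big_split; apply: eq_bigr => i _; rewrite mxE mulrDr.
Qed.

Lemma dotvZr u a v : dotv u (a *: v) = a * dotv u v.
Proof.
by rewrite /dotv mulr_sumr; apply: eq_bigr => i _; rewrite mxE mulrCA.
Qed.

Lemma dotvNr u v : dotv u (- v) = - dotv u v.
Proof. by rewrite -scaleN1r dotvZr mulN1r. Qed.

Lemma dotvBr u v w : dotv u (v - w) = dotv u v - dotv u w.
Proof. by rewrite dotvDr dotvNr. Qed.

Lemma dotv0r u : dotv u 0 = 0.
Proof. by rewrite -(scale0r u) dotvZr mul0r. Qed.

Lemma dotv_sumr u I (r : seq I) (P : pred I) (F : I -> V) :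
  dotv u (\sum_(i <- r | P i) F i) = \sum_(i <- r | P i) dotv u (F i).
Proof.
by elim/big_rec2 : _ => [|i x y _ <-]; rewrite ?dotv0r// dotvDr.
Qed.

Lemma dotvDl u v w : dotv (v + w) u = dotv v u + dotv w u.
Proof. by rewrite dotvC dotvDr !(dotvC u). Qed.

Lemma dotvZl u a v : dotv (a *: v) u = a * dotv v u.
Proof. by rewrite dotvC dotvZr dotvC. Qed.

Lemma dotvNl u v : dotv (- v) u = - dotv v u.
Proof. by rewrite dotvC dotvNr dotvC. Qed.

Lemma dotvBl u v w : dotv (v - w) u = dotv v u - dotv w u.
Proof. by rewrite dotvDl dotvNl. Qed.

Lemma dotv0l u : dotv 0 u = 0.
Proof. by rewrite dotvC dotv0r. Qed.

Lemma dotv_suml u I (r : seq I) (P : pred I) (F : I -> V) :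
  dotv (\sum_(i <- r | P i) F i) u = \sum_(i <- r | P i) dotv (F i) u.
Proof. by rewrite dotvC dotv_sumr; apply: eq_bigr => i _; rewrite dotvC. Qed.

Definition dotvE := (dotvDr, dotvDl, dotvNr, dotvNl, dotvZr, dotvZl, dotv0l, dotv0r).

Lemma dotv_eq0 v : (dotv v v == 0) = (v == 0).
Proof.
apply/idP/idP => [|/eqP ->]; last by rewrite dotv0l.
rewrite psumr_eq0; last by move=> i _; rewrite -expr2 sqr_ge0.
move=> /allP v0; apply/eqP/rowP => i; rewrite mxE.
by apply/eqP; rewrite -sqrf_eq0 expr2; apply: v0; rewrite mem_index_enum.
Qed.

Lemma dotv_gt0 v : v != 0 -> 0 < dotv v v.
Proof. by move=> v0; rewrite lt_neqAle eq_sym dotv_eq0 v0 dotv_ge0. Qed.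

Lemma cauchy_schwarz_dotv u v : dotv u v ^+ 2 <= dotv u u * dotv v v.
Proof.
have [->|v0] := eqVneq v 0; first by rewrite !dotv0r expr0n mulr0.
(* This vector is |v|^2 times the component of u orthogonal to v. *)
have := dotv_ge0 (dotv v v *: u - dotv u v *: v).
rewrite !dotvE (dotvC v u) => H.
have {H}: 0 <= dotv v v * (dotv u u * dotv v v - dotv u v ^+ 2) by nra.
by rewrite pmulr_rge0 ?dotv_gt0// subr_ge0.
Qed.

Lemma enorm_ge0 v : 0 <= enorm v.
Proof. exact: sqrtr_ge0. Qed.

Lemma sqr_enorm v : enorm v ^+ 2 = dotv v v.
Proof. by rewrite sqr_sqrtr ?dotv_ge0. Qed.

Lemma ler_dotv u v : `|dotv u v| <= enorm u * enorm v.
Proof.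
rewrite -[leLHS]sqrtr_sqr /enorm -sqrtrM ?dotv_ge0// ler_sqrt.
  exact: cauchy_schwarz_dotv.
by rewrite mulr_ge0// dotv_ge0.
Qed.

Lemma enormD u v : enorm (u + v) <= enorm u + enorm v.
Proof.
rewrite -(@ler_pXn2r _ 2%N)// ?nnegrE ?addr_ge0 ?enorm_ge0//.
rewrite sqrrD !sqr_enorm !dotvE (dotvC v u).
by have := le_trans (ler_norm _) (ler_dotv u v); lra.
Qed.

Lemma enormZ a v : enorm (a *: v) = `|a| * enorm v.
Proof.
by rewrite /enorm !dotvE mulrA -expr2 sqrtrM ?sqr_ge0// sqrtr_sqr.
Qed.

Lemma enormN v : enorm (- v) = enorm v.
Proof. by rewrite /enorm !dotvE opprK. Qed.

Lemma enorm_gt0 v : (0 < enorm v) = (v != 0).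
Proof.
apply/idP/idP => [|v0]; last by rewrite sqrtr_gt0 dotv_gt0.
by apply: contraTneq => ->; rewrite /enorm dotv0l sqrtr0 ltxx.
Qed.

Lemma enorm_ltP v r : 0 < r -> (enorm v < r) = (dotv v v < r ^+ 2).
Proof.
by move=> r0; rewrite -sqr_enorm ltr_pXn2r// nnegrE ?enorm_ge0// ltW.
Qed.

Lemma le_coord_enorm v i : `|v 0 i| <= enorm v.
Proof.
rewrite -[leLHS]sqrtr_sqr /enorm ler_sqrt ?dotv_ge0//.
rewrite /dotv (bigD1 i)//= -expr2 lerDl sumr_ge0// => j _.
by rewrite -expr2 sqr_ge0.
Qed.

(** The divisor [m.+1], cruder than the square root of m, keeps the inequality strict in dimension 0
    as well, since m < (m + 1)^2. *)
Lemma enorm_lt_coord v r : 0 < r -> (forall i, `|v 0 i| < r / m.+1%:R) ->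
  enorm v < r.
Proof.
move=> r0 vr; rewrite enorm_ltP//.
apply: (@le_lt_trans _ _ (\sum_(i < m) (r / m.+1%:R) ^+ 2)).
  apply: ler_sum => i _; rewrite -expr2 -real_normK ?num_real//.
  by rewrite lerXn2r ?nnegrE// ?divr_ge0// ltW.
rewrite sumr_const card_ord -[X in X < _]mulr_natl expr_div_n.
have m0 : 0 < m.+1%:R :> R by rewrite ltr0n.
rewrite mulrA ltr_pdivrMr ?exprn_gt0// mulrC ltr_pM2l ?exprn_gt0//.
by rewrite -natrX ltr_nat expnS expn1; exact: leq_pmulr.
Qed.

Lemma ball_rVP (x y : V) r : 0 < r ->
  ball x r y <-> forall i, `|x 0 i - y 0 i| < r.
Proof.
move=> r0; split => [[_ H] i|H]; first exact: H.
by split => // i j; rewrite (ord1 i); exact: H.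
Qed.

(** The topology comes from the sup norm; the two norms are comparable by [le_coord_enorm] and
    [enorm_lt_coord]. *)
Lemma nbhs_enormP x (A : set V) :
  nbhs x A <-> exists2 r, 0 < r & forall y, enorm (y - x) < r -> A y.
Proof.
split=> [/nbhs_ballP[r /= r0 xA]|[r r0 xA]].
  exists r => // y yx; apply: xA; apply/ball_rVP => // i.
  by rewrite distrC (le_lt_trans _ yx)// (le_trans _ (le_coord_enorm _ i))// !mxE.
have m0 : 0 < m.+1%:R :> R by rewrite ltr0n.
apply/nbhs_ballP; exists (r / m.+1%:R) => /=; first by rewrite divr_gt0.
move=> y /ball_rVP xy; apply: xA; apply: enorm_lt_coord => // i.
by rewrite !mxE distrC xy// divr_gt0.
Qed.

Lemma dotv_continuous u : continuous (dotv u).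
Proof.
apply: continuous_sum => i x; apply: continuousM; first exact: cst_continuous.
exact: coord_continuous.
Qed.

Lemma dotv_sqr_continuous : continuous (fun v : V => dotv v v).
Proof.
apply: continuous_sum => i x; apply: continuousM; exact: coord_continuous.
Qed.

Lemma closed_dotv_ge u v : closed [set x | dotv x u <= dotv x v].
Proof.
rewrite (_ : [set _ | _] = dotv (v - u) @^-1` [set r | 0 <= r]).
  by apply: preimage_closed; [move=> x _; exact: dotv_continuous|exact: closed_ge].
by apply/seteqP; split => x /=; rewrite dotvBl !(dotvC x) subr_ge0.
Qed.

Lemma measurable_box (p : V) r :
  measurable [set v : V | forall i, ball (p 0 i) r (v 0 i)].
Proof.
rewrite (_ : [set _ | _] = \bigcap_(i in [set: 'I_m]) ((fun v : V => v 0 i) @^-1` ball (p 0 i) r)).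
  apply: fin_bigcap_measurable => // i _.
  apply: measurable_preimage; [exact: measurable_coord|exact: measurable_ball].
by apply/seteqP; split => v /= H i; [move=> _; exact: H|exact: H].
Qed.

(** The sigma-algebra is generated by coordinates, so the open set is written as the countable union
    of the boxes with rational center and radius 1 / (k + 1) that it contains. *)
Lemma open_measurable_rV (A : set V) : open A -> measurable A.
Proof.
move=> oA.
pose B (p : 'rV[rat]_m * nat) : set V :=
  [set v | forall i, ball (ratr (p.1 0 i) : R) (p.2.+1%:R^-1) (v 0 i)].
rewrite (_ : A = \bigcup_p (if `[< B p `<=` A >] then B p else set0)).
  apply: countable_bigcupT_measurable => // p.
  case: ifP => // _; rewrite (_ : B p = [set v : V |
    forall i, ball ((\row_j (ratr (p.1 0 j) : R)) 0 i) (p.2.+1%:R^-1) (v 0 i)]).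
    exact: measurable_box.
  by apply/seteqP; split => v /= H i; have := H i; rewrite mxE.
apply/seteqP; split => [v Av|v [p _]]; last by case: ifPn => // /asboolP; exact.
have [r r0 vA] := (nbhs_enormP v A).1 (open_nbhs_nbhs (conj oA Av)).
have m0 : 0 < m.+1%:R :> R by rewrite ltr0n.
(* Halved because a point of the box and [v] are compared through the rational center. *)
have rm0 : 0 < r / m.+1%:R / 2 by rewrite !divr_gt0.
have [k /= kr] := filter_ex (near_infty_natSinv_lt (PosNum rm0)).
have k0 : 0 < k.+1%:R^-1 :> R by rewrite invr_gt0.
have /choice[q qv] : forall i, exists q : rat, ball (ratr q : R) (k.+1%:R^-1) (v 0 i).
  move=> i; have [|q] := @rat_in_itvoo R (v 0 i - k.+1%:R^-1) (v 0 i + k.+1%:R^-1).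
    by rewrite ltrD2l gtrN.
  rewrite in_itv /= => /andP[q1 q2]; exists q.
  by rewrite /ball/= ltr_norml ltrBrDl q1 ltrBlDl q2.
exists (\row_i q i, k) => //; rewrite ifT.
  by move=> i; rewrite /= mxE.
apply/asboolP => w wB; apply: vA; apply: enorm_lt_coord => // i.
have := wB i; rewrite /= !mxE => wBi; exact: ltr_distm_half kr wBi (qv i).
Qed.

Lemma closed_measurable_rV (A : set V) : closed A -> measurable A.
Proof.
move=> cA; rewrite -(setCK A); apply: measurableC.
by apply: open_measurable_rV; exact: closed_openC.
Qed.

Lemma lebesgue_rV_nbhs_gt0 (A : set V) x : measurable A -> nbhs x A ->
  (0 < lebesgue_rV m A)%E.
Proof.
move=> mA /nbhs_ballP[r /= r0 xA].
apply: (@lt_le_trans _ _ (lebesgue_rV m [set v | forall i, ball (x 0 i) r (v 0 i)])).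
  by rewrite lebesgue_rV_box// lte_fin exprn_gt0// pmulrn_lgt0.
apply: le_measure; rewrite ?inE; [exact: measurable_box|by []|].
by move=> v H; apply: xA; apply/ball_rVP.
Qed.

Lemma lebesgue_rV_eball_fin : (lebesgue_rV m [set v : V | (enorm v <= 1)%R] < +oo)%E.
Proof.
apply: (@le_lt_trans _ _ (lebesgue_rV m [set v | forall i, ball ((0 : V) 0%R i) 2%R (v 0%R i)])).
  apply: le_measure; rewrite ?inE; [exact: measurable_eball|exact: measurable_box|].
  move=> v v1 i; rewrite /ball/= mxE sub0r normrN.
  by rewrite (le_lt_trans (le_coord_enorm _ _))// (le_lt_trans v1)// ltr1n.
by rewrite lebesgue_rV_box// ltry.
Qed.

Lemma lebesgue_rV_eball_gt0 : (0 < lebesgue_rV m [set v : V | (enorm v <= 1)%R])%E.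
Proof.
apply: (@lt_le_trans _ _ (lebesgue_rV m
  [set v | forall i, ball ((0 : V) 0 i) (m.+1%:R^-1) (v 0 i)])).
  by rewrite lebesgue_rV_box ?invr_gt0// lte_fin exprn_gt0// pmulrn_lgt0 ?invr_gt0.
apply: le_measure; rewrite ?inE; [exact: measurable_box|exact: measurable_eball|].
move=> v vb; apply/ltW/enorm_lt_coord => // i.
by have := vb i; rewrite /ball/= mxE sub0r normrN mul1r.
Qed.


End dot_product.

(** * Unit vectors, normalisation and the reflection about the center *)

Section reflection.
Context {R : realType} (n : nat).
Local Notation V := 'rV[R]_n.+1.
Implicit Types (u v w x y e : V) (a : R).

Lemma sphereP v : sphere n v <-> dotv v v = 1.
Proof.
rewrite /sphere/= -sqr_enorm; split=> [->|]; first by rewrite expr1n.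
by move/eqP; rewrite sqrp_eq1 ?enorm_ge0// => /eqP.
Qed.

Lemma sphere_neq0 v : sphere n v -> v != 0.
Proof.
by move=> /sphereP v1; apply/eqP => v0; move: v1; rewrite v0 dotv0l => /eqP;
  rewrite eq_sym oner_eq0.
Qed.

Lemma sphere_normalize v : v != 0 -> sphere n (normalize v).
Proof.
move=> v0; rewrite /sphere/= /normalize enormZ normfV ger0_norm ?enorm_ge0//.
by rewrite mulVf// gt_eqF// enorm_gt0.
Qed.

Lemma normalizeK v : enorm v *: normalize v = v.
Proof.
have [->|v0] := eqVneq v 0; first by rewrite /normalize !scaler0.
by rewrite /normalize scalerA divff ?scale1r// gt_eqF// enorm_gt0.
Qed.

(** Normalising moves v by |1 - |v||, which is at most |v - x| because x is a unit vector. *)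
Lemma normalize_close x v : sphere n x -> v != 0 ->
  enorm (normalize v - x) <= 2 * enorm (v - x).
Proof.
move=> x1 v0.
have -> : normalize v - x = (1 - enorm v) *: normalize v + (v - x).
  by rewrite scalerBl scale1r normalizeK addrA subrK.
rewrite (le_trans (enormD _ _))// enormZ (sphere_normalize v0) mulr1.
have H1 := enormD (v - x) x; have H2 := enormD (x - v) v.
rewrite !subrK x1 -[enorm (x - v)]enormN opprB in H1 H2.
suff : `|1 - enorm v| <= enorm (v - x) by lra.
by rewrite ler_norml; apply/andP; split; lra.
Qed.

Lemma normalize_sphere v : sphere n v -> normalize v = v.
Proof. by move=> v1; rewrite /normalize v1 invr1 scale1r. Qed.

Lemma normalizeZ a v : 0 < a -> normalize (a *: v) = normalize v.
Proof.
move=> a0; have [->|v0] := eqVneq v 0; first by rewrite scaler0.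
rewrite /normalize enormZ gtr0_norm// scalerA invfM mulrAC mulVf ?mul1r//.
by rewrite gt_eqF.
Qed.

Lemma normalize_lipschitz v w : v != 0 -> w != 0 ->
  enorm (normalize w - normalize v) <= 2 * (enorm v)^-1 * enorm (w - v).
Proof.
move=> v0 w0; have nv : 0 < (enorm v)^-1 by rewrite invr_gt0 enorm_gt0.
rewrite -(normalizeZ w nv); apply: le_trans (normalize_close _ _) _.
- exact: sphere_normalize.
- by rewrite scaler_eq0 (gt_eqF nv) (negPf w0).
- by rewrite -mulrA -scalerBr enormZ ger0_norm// ltW.
Qed.

Lemma exists_orth e : (0 < n)%N -> exists2 u, sphere n u & dotv u e = 0.
Proof.
case: n e => // k e _.
(* The first two coordinates of [e] turned by a right angle, unless the first one is zero, where
   this could vanish. *)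
pose u : 'rV[R]_k.+2 := if e 0 ord0 == 0 then delta_mx 0 ord0
  else e 0 (lift ord0 ord0) *: delta_mx 0 ord0 - e 0 ord0 *: delta_mx 0 (lift ord0 ord0).
have dE (i : 'I_k.+2) : dotv (delta_mx 0 i) e = e 0 i.
  rewrite /dotv (bigD1 i)//= mxE !eqxx mul1r big1 ?addr0// => j ji.
  by rewrite mxE (negPf ji) andbF mul0r.
have u0 : u != 0.
  rewrite /u; case: (eqVneq (e 0 ord0) 0) => [_|e0]; apply/eqP => /rowP.
    by move=> /(_ ord0); rewrite !mxE !eqxx => /eqP; rewrite oner_eq0.
  move=> /(_ (lift ord0 ord0)); rewrite !mxE /= mulr0 mulr1 sub0r => /eqP.
  by rewrite oppr_eq0 (negPf e0).
have ue : dotv u e = 0.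
  rewrite /u; case: (eqVneq (e 0 ord0) 0) => [e0|_]; first by rewrite dE.
  by rewrite dotvBl !dotvZl !dE; ring.
exists (normalize u).
  rewrite /sphere/= /normalize enormZ normfV ger0_norm ?enorm_ge0//.
  by rewrite mulVf// gt_eqF// enorm_gt0.
by rewrite /normalize dotvZl ue mulr0.
Qed.

Variable e : V.
Hypothesis e1 : sphere n e.
Let ee : dotv e e = 1. Proof. exact/sphereP. Qed.

Lemma reflect_aboutD : {morph reflect_about e : x y / x + y}.
Proof.
by move=> x y; rewrite /reflect_about dotvDl mulrDr scalerDl opprD addrACA.
Qed.

Lemma reflect_aboutZ a x : reflect_about e (a *: x) = a *: reflect_about e x.
Proof. by rewrite /reflect_about dotvZl scalerDr scalerN scalerA mulrCA. Qed.

Lemma reflect_aboutK : involutive (reflect_about e).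
Proof.
move=> x; rewrite /reflect_about !dotvE ee; apply/rowP => i; rewrite !mxE.
ring.
Qed.

Lemma dotv_reflect_center x : dotv (reflect_about e x) e = dotv x e.
Proof. by rewrite /reflect_about !dotvE ee; ring. Qed.

Lemma dotv_reflect_orth x u : dotv u e = 0 -> dotv (reflect_about e x) u = - dotv x u.
Proof. by move=> ue; rewrite /reflect_about !dotvE (dotvC e) ue mulr0 addr0. Qed.

Lemma enorm_reflect x : enorm (reflect_about e x) = enorm x.
Proof.
rewrite /enorm /reflect_about !dotvE ee (dotvC e x); congr Num.sqrt; ring.
Qed.

Lemma normalize_reflect x : normalize (reflect_about e x) = reflect_about e (normalize x).
Proof. by rewrite /normalize enorm_reflect reflect_aboutZ. Qed.

Lemma measurable_reflect : measurable_fun setT (reflect_about e).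
Proof.
apply/measurable_fun_rVP => i; rewrite /reflect_about.
under eq_fun do rewrite !mxE.
apply: measurable_funD; first by apply: measurable_funN; exact: measurable_coord.
apply: measurable_funM; last exact: measurable_cst.
apply: measurable_funM; first exact: measurable_cst.
by under eq_fun do rewrite dotvC; exact: measurable_dotv.
Qed.

End reflection.


(** * Spherical measure, moments and widths *)

Section spherical_measure.
Context {R : realType} (n : nat).
Local Notation V := 'rV[R]_n.+1.
Local Notation sigma := (@spherical_measure R n).
Implicit Types (A B K D : set V) (u v w x y e : V) (a : R) (f g : V -> R).

Lemma spherical_measure_lty A : measurable A -> (sigma A < +oo)%E.
Proof.
move=> mA; rewrite /spherical_measure lte_mul_pinfty//.
apply: le_lt_trans (lebesgue_rV_eball_fin n.+1); apply: le_measure; rewrite ?inE.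
- apply: measurableI; last exact: measurable_eball.
  exact: measurable_preimage (@measurable_normalize _ _) _.
- exact: measurable_eball.
- by move=> v [].
Qed.

(** [lebesgue_rV_involution] with [B] the unit ball: the reflection is linear, preserves the ball
    and commutes with [normalize]. *)
Lemma spherical_measure_reflect e A : sphere n e -> measurable A ->
  sigma (reflect_about e @^-1` A) = sigma A.
Proof.
move=> e1 mA; rewrite /spherical_measure; congr (_ * _)%E.
set B := [set v : V | (enorm v <= 1)%R].
have mN := @measurable_normalize R n.+1.
rewrite -(@lebesgue_rV_involution _ _ (reflect_about e) (normalize @^-1` A `&` B) B).
- congr (lebesgue_rV _ _); apply/seteqP; split => v [] /=.
    by rewrite /B/= (normalize_reflect e1) (enorm_reflect e1).
  by rewrite /B/= (normalize_reflect e1) (enorm_reflect e1).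
- exact: measurable_reflect.
- exact: reflect_aboutD.
- exact: reflect_aboutK.
- apply: measurableI; last exact: measurable_eball.
  exact: measurable_preimage mN mA.
- exact: measurable_eball.
- by apply/seteqP; split => v /=; rewrite /B/= (enorm_reflect e1).
- by apply/seteqP; split => v /=; rewrite /B/= enormN.
- by rewrite lebesgue_rV_eball_gt0 lebesgue_rV_eball_fin.
Qed.

Lemma measurable_dotv_set u (B : set R) : measurable B ->
  measurable [set x : V | B (dotv u x)].
Proof. by move=> mB; exact: measurable_preimage (measurable_dotv u) mB. Qed.

Lemma spherical_measure_hyperplane u : u != 0 ->
  sigma [set x | dotv u x = 0] = 0%E.
Proof.
move=> u0; rewrite /spherical_measure.
rewrite (_ : lebesgue_rV _ _ = 0%E) ?mule0//; apply/eqP.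
rewrite eq_le measure_ge0 andbT -(lebesgue_rV_hyperplane 0 u0).
have mH : measurable [set x : V | dotv u x = 0].
  exact: (measurable_dotv_set u (measurable_set1 (0 : R))).
apply: le_measure; rewrite ?inE//.
- apply: measurableI; last exact: measurable_eball.
  exact: measurable_preimage (@measurable_normalize _ _) mH.
- move=> v [/= uv _]; rewrite -(normalizeK v) dotvZr.
  by rewrite uv mulr0.
Qed.

Lemma sinteriorP A x : sphere n x -> sinterior A x <->
  exists2 r, 0 < r & forall y, sphere n y -> enorm (y - x) < r -> A y.
Proof.
move=> x1; change (nbhs_subspace (x : subspace (sphere n)) A <->
  exists2 r, 0 < r & forall y, sphere n y -> enorm (y - x) < r -> A y).
rewrite -nbhs_subspace_in// /within/=.
split=> [/nbhs_enormP[r r0 H]|[r r0 H]]; last first.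
  by apply/nbhs_enormP; exists r => // y yx y1; exact: H.
by exists r => // y y1 yx; exact: H.
Qed.

Lemma sinterior_sub A : sinterior A `<=` A.
Proof. exact: (@interior_subset (subspace (sphere n)) A). Qed.

Lemma spherical_measure_gt0 A : measurable A -> A `<=` sphere n ->
  sinterior A !=set0 -> (0 < sigma A)%E.
Proof.
move=> mA As [x xA]; have x1 := As _ (sinterior_sub xA).
have [r r0 rA] := (sinteriorP _ x1).1 xA.
rewrite /spherical_measure mule_gt0//.
(* The point x / 2 is interior to the unit ball and away from the origin, so points near it project
   close to x. *)
apply: (@lebesgue_rV_nbhs_gt0 _ _ _ (2^-1 *: x)).
  apply: measurableI; last exact: measurable_eball.
  exact: measurable_preimage (@measurable_normalize _ _) mA.
(* Doubling and normalising turn the distance s into at most 4 s < r; s <= 1/4 keeps v nonzero and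
   inside the ball. *)
have [s [s0 sr s4]] : exists s : R, [/\ 0 < s, s <= r / 5 & s <= 1 / 4].
  exists (Num.min (r / 5) (1 / 4)).
  by rewrite lt_min !ge_min !lexx orbT; split => //; apply/andP; split; lra.
apply/nbhs_enormP; exists s => // v vx.
have nx : enorm (2^-1 *: x) = 2^-1 by rewrite enormZ x1 mulr1 ger0_norm.
have v1 : enorm v <= 2^-1 + s.
  by rewrite -(subrK (2^-1 *: x) v) (le_trans (enormD _ _))// nx addrC lerD2l ltW.
have v2 : 2^-1 - s <= enorm v.
  have := enormD (2^-1 *: x - v) v; rewrite subrK nx.
  by rewrite -enormN opprB => H; lra.
have v0 : v != 0 by rewrite -enorm_gt0; lra.
split; last by rewrite /=; lra.
apply: rA; first exact: sphere_normalize.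
rewrite -(normalizeZ v (ltr0n R 2)).
apply: le_lt_trans (normalize_close x1 _) _.
  by rewrite scaler_eq0 negb_or v0 andbT pnatr_eq0.
rewrite (_ : 2 *: v - x = 2 *: (v - 2^-1 *: x)); last first.
  by rewrite scalerBr scalerA divff ?scale1r// pnatr_eq0.
by rewrite enormZ normr_nat; lra.
Qed.

Lemma integrable_sphere D f C : measurable D -> D `<=` sphere n ->
  measurable_fun setT f -> (forall x, sphere n x -> `|f x| <= C) ->
  sigma.-integrable D (EFin \o f).
Proof.
move=> mD Ds mf fC; apply: measurable_bounded_integrable => //.
- exact: spherical_measure_lty.
- exact: measurable_funTS.
- exists C; split; first exact: num_real.
  by move=> M CM x /Ds x1 /=; rewrite (le_trans (fC _ x1))// ltW.
Qed.

Lemma Rintegral_reflect e D f C : sphere n e -> measurable D -> D `<=` sphere n ->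
  measurable_fun setT f -> (forall x, sphere n x -> `|f x| <= C) ->
  Rintegral sigma (reflect_about e @^-1` D) (f \o reflect_about e) =
  Rintegral sigma D f.
Proof.
move=> e1 mD Ds mf fC; have mr := measurable_reflect e.
rewrite /Rintegral; congr fine.
transitivity (\int[pushforward sigma (reflect_about e)]_(x in D) (f x)%:E)%E.
  rewrite integral_pushforward//; first exact/measurable_EFinP.
  apply: (@integrable_sphere _ (f \o reflect_about e) C).
  - exact: measurable_preimage mr mD.
  - by move=> x /= /Ds; rewrite /sphere/= (enorm_reflect e1).
  - exact: measurableT_comp mf mr.
  - by move=> x x1; apply: fC; rewrite /sphere/= (enorm_reflect e1).
by apply: eq_measure_integral => A mA _; exact: spherical_measure_reflect.
Qed.

Lemma Rintegral_null D f : measurable D -> measurable_fun setT f ->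
  sigma D = 0%E -> Rintegral sigma D f = 0.
Proof.
move=> mD mf D0; rewrite /Rintegral null_set_integral//.
by apply/measurable_EFinP; exact: measurable_funTS.
Qed.

Lemma ler_dotv_sphere u x : sphere n x -> `|dotv u x| <= enorm u.
Proof. by move=> x1; rewrite (le_trans (ler_dotv _ _))// x1 mulr1. Qed.

End spherical_measure.

(** * Moments of the halves of a symmetric body *)

Section moments.
Context {R : realType} (n : nat).
Local Notation V := 'rV[R]_n.+1.
Local Notation sigma := (@spherical_measure R n).
Implicit Types (A B D : set V) (u v w x y : V) (a : R) (f g : V -> R).
Variable K : set V.
Hypotheses (mK : measurable K) (Ksph : K `<=` sphere n).

Lemma hemisphereE u : K `&` hemisphere u = K `&` [set x | 0 <= dotv u x].
Proof.
by apply/seteqP; split => x [Kx]; [move=> [_ ?]|move=> ux; split => //; split => //; exact: Ksph].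
Qed.

Lemma measurable_hemisphere u : measurable (K `&` hemisphere u).
Proof.
rewrite hemisphereE; apply: measurableI => //.
rewrite (_ : [set _ | _] = [set x | `[0, +oo[%classic (dotv u x)]).
  exact: measurable_dotv_set.
by apply/seteqP; split => x /=; rewrite in_itv/= andbT.
Qed.

(** The two closed hemispheres overlap in a great subsphere only, which is null. *)
Lemma Rintegral_hemispheres u f C : u != 0 -> measurable_fun setT f ->
  (forall x, sphere n x -> `|f x| <= C) ->
  Rintegral sigma K f =
  Rintegral sigma (K `&` hemisphere u) f + Rintegral sigma (K `&` hemisphere (- u)) f.
Proof.
move=> u0 mf fC.
have mKu := measurable_hemisphere u.
have mKn := measurable_hemisphere (- u).
have mH0 : measurable [set x : V | dotv u x = 0].
  exact: (measurable_dotv_set u (measurable_set1 (0 : R))).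
have mH : measurable (K `&` [set x | dotv u x = 0]) by exact: measurableI.
have mL : measurable (K `&` [set x | dotv u x < 0]).
  apply: measurableI => //.
  rewrite (_ : [set _ | _] = [set x | `]-oo, 0[%classic (dotv u x)]).
    exact: measurable_dotv_set.
  by apply/seteqP; split => x /=; rewrite in_itv.
have KE : K = (K `&` hemisphere u) `|` (K `&` [set x | dotv u x < 0]).
  rewrite hemisphereE -setIUr; apply/esym/setIidl => x _ /=.
  by case: (leP 0 (dotv u x)) => ?; [left|right].
have KnE : K `&` hemisphere (- u) =
    (K `&` [set x | dotv u x < 0]) `|` (K `&` [set x | dotv u x = 0]).
  rewrite hemisphereE -setIUr; congr (_ `&` _); apply/seteqP; split => x /=.
    by rewrite dotvNl oppr_ge0 le_eqVlt => /orP[/eqP|]; [right|left].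
  by rewrite dotvNl oppr_ge0 => -[/ltW//|->].
rewrite KnE [in RHS]Rintegral_setU//.
- rewrite (@Rintegral_null _ _ (K `&` [set x | dotv u x = 0]))//.
    rewrite addr0 {1}KE Rintegral_setU// -?KE.
      exact: integrable_sphere mf fC.
    apply/disj_setPS => x [[_ [_ /= ux]] [_ /=]].
    by rewrite ltNge ux.
  apply/eqP; rewrite eq_le measure_ge0 andbT -(spherical_measure_hyperplane u0).
  by apply: le_measure; rewrite ?inE.
- rewrite -KnE; apply: integrable_sphere mf fC => //.
  by move=> x [/Ksph].
- by apply/disj_setPS => x [[_ /= ux] [_ /= ux0]]; rewrite ux0 ltxx in ux.
Qed.

(** The centroid before normalisation: [centroid] of [K] cut by [hemisphere u] is
    [normalize (moment u)]. *)
Definition moment u : V :=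
  \row_i Rintegral sigma (K `&` hemisphere u) (fun x => x 0 i).

Lemma dotv_moment u v :
  dotv (moment u) v = Rintegral sigma (K `&` hemisphere u) (dotv v).
Proof.
have mKu := measurable_hemisphere u.
have Kus : K `&` hemisphere u `<=` sphere n by move=> x [/Ksph].
have ic i : sigma.-integrable (K `&` hemisphere u) (EFin \o (fun x => x 0 i)).
  apply: (@integrable_sphere _ _ _ _ 1) => //; first exact: measurable_coord.
  by move=> x x1; rewrite (le_trans (le_coord_enorm _ _))// x1.
have icv i : sigma.-integrable (K `&` hemisphere u) (EFin \o (fun x => v 0 i * x 0 i)).
  exact: (integrableZl mKu (v 0 i) (ic i)).
rewrite [RHS](@Rintegral_sum _ _ _ _ _ _ (fun i x => v 0 i * x 0 i))//.
by apply: eq_bigr => i _; rewrite RintegralZl// mxE mulrC.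
Qed.

Variable e : V.
Hypothesis e1 : sphere n e.
Hypothesis Ksym : reflect_about e @` K = K.
Hypothesis Khemi : K `<=` hemisphere e.

(** This is b(u) of the overview: the cosine transform of [sigma] restricted to [K]. *)
Definition width u : R := Rintegral sigma K (fun x => `|dotv u x|).

Lemma reflect_hemisphere u : dotv u e = 0 ->
  reflect_about e @^-1` (K `&` hemisphere u) = K `&` hemisphere (- u).
Proof.
move=> ue; rewrite !hemisphereE; apply/seteqP; split => x /= [].
  rewrite -{1}Ksym => -[y Ky] /(can_inj (reflect_aboutK e1)) <-.
  by rewrite !(dotvC _ (reflect_about _ _)) dotv_reflect_orth// dotvNl (dotvC u).
rewrite dotvNl -{1}Ksym => -[y Ky <-].
by rewrite reflect_aboutK// !(dotvC u) dotv_reflect_orth// opprK.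
Qed.

Lemma measurable_norm_dotv u : measurable_fun setT (fun x : V => `|dotv u x|).
Proof. by apply: measurableT_comp => //; exact: measurable_dotv. Qed.

Lemma width_center : width e = Rintegral sigma K (dotv e).
Proof.
by apply: eq_Rintegral => x; rewrite inE => /Khemi[_ ex]; rewrite ger0_norm.
Qed.

Lemma moment_center u : u != 0 -> dotv u e = 0 ->
  dotv (moment u) e *+ 2 = width e.
Proof.
move=> u0 ue; have mKu := measurable_hemisphere u.
have Kus : K `&` hemisphere u `<=` sphere n by move=> x [/Ksph].
rewrite mulr2n dotv_moment width_center.
rewrite (@Rintegral_hemispheres u _ (enorm e))//; last 2 first.
- exact: measurable_dotv.
- exact: ler_dotv_sphere.
congr (_ + _).
rewrite -(@Rintegral_reflect _ _ e _ _ (enorm e))//; last 2 first.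
- exact: measurable_dotv.
- exact: ler_dotv_sphere.
rewrite reflect_hemisphere//; apply: eq_Rintegral => x _.
rewrite -[LHS]/(dotv e (reflect_about e x)) -[RHS]/(dotv e x).
by rewrite !(dotvC e) dotv_reflect_center.
Qed.

(** The reflection flips the sign of the component along v and exchanges the two halves, so the
    second copy of the moment becomes an integral over the opposite half. The sum can then be
    compared with [width v], split along the same halves. *)
Lemma moment_orth u v : dotv u e = 0 -> dotv v e = 0 ->
  dotv (moment u) v *+ 2 =
  Rintegral sigma (K `&` hemisphere u) (dotv v) +
  Rintegral sigma (K `&` hemisphere (- u)) (dotv (- v)).
Proof.
move=> ue ve; have mKu := measurable_hemisphere u.
have Kus : K `&` hemisphere u `<=` sphere n by move=> x [/Ksph].
rewrite mulr2n dotv_moment; congr (_ + _).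
rewrite -(@Rintegral_reflect _ _ e _ _ (enorm v))//; last 2 first.
- exact: measurable_dotv.
- exact: ler_dotv_sphere.
rewrite reflect_hemisphere//; apply: eq_Rintegral => x _.
rewrite -[LHS]/(dotv v (reflect_about e x)) -[RHS]/(dotv (- v) x).
by rewrite dotvNl !(dotvC v) dotv_reflect_orth.
Qed.

(** With equality at v = u ([moment_width]): the part of twice the moment orthogonal to [e] is a
    touching point, in direction u, of the convex body with support function [width]. *)
Lemma moment_le_width u v : u != 0 -> dotv u e = 0 -> dotv v e = 0 ->
  dotv (moment u) v *+ 2 <= width v.
Proof.
move=> u0 ue ve; rewrite moment_orth// /width.
have nb x : sphere n x -> `|(`|dotv v x|)| <= enorm v.
  by move=> x1; rewrite normr_id; exact: ler_dotv_sphere.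
rewrite (@Rintegral_hemispheres u _ (enorm v))//; last exact: measurable_norm_dotv.
have Kus w : K `&` hemisphere w `<=` sphere n by move=> x [/Ksph].
have mKu := measurable_hemisphere.
apply: lerD; apply: le_Rintegral => //.
- exact: (integrable_sphere _ _ (measurable_dotv v) (@ler_dotv_sphere _ _ v)).
- exact: (integrable_sphere _ _ (measurable_norm_dotv v) nb).
- by move=> x _; exact: ler_norm.
- exact: (integrable_sphere _ _ (measurable_dotv (- v)) (@ler_dotv_sphere _ _ (- v))).
- exact: (integrable_sphere _ _ (measurable_norm_dotv v) nb).
- by move=> x _; rewrite -[leLHS]/(dotv (- v) x) dotvNl -normrN ler_norm.
Qed.

Lemma moment_width u : u != 0 -> dotv u e = 0 -> dotv (moment u) u *+ 2 = width u.
Proof.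
move=> u0 ue; rewrite moment_orth// /width.
have nb x : sphere n x -> `|(`|dotv u x|)| <= enorm u.
  by move=> x1; rewrite normr_id; exact: ler_dotv_sphere.
rewrite (@Rintegral_hemispheres u _ (enorm u))//; last exact: measurable_norm_dotv.
congr (_ + _); apply: eq_Rintegral => x; rewrite inE => -[_ [_]].
  by move=> ux; rewrite -[LHS]/(dotv u x) ger0_norm.
rewrite dotvNl => ux; rewrite -[LHS]/(dotv (- u) x) dotvNl ler0_norm//.
by rewrite -oppr_ge0.
Qed.

End moments.

(** * The width as a support function: bounds, continuity, gradient *)

Section width.
Context {R : realType} (n : nat).
Local Notation V := 'rV[R]_n.+1.
Local Notation sigma := (@spherical_measure R n).
Implicit Types (A B D : set V) (u v w x y : V) (a : R) (f g : V -> R).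
Variable K : set V.
Hypotheses (mK : measurable K) (Ksph : K `<=` sphere n).
Hypothesis K0 : (0 < sigma K)%E.

Local Notation s := (fine (sigma K)).

Lemma spherical_measure_fineK A : measurable A -> (fine (sigma A))%:E = sigma A.
Proof. by move=> mA; rewrite fineK// ge0_fin_numE ?spherical_measure_lty. Qed.

Lemma fine_spherical_measure_gt0 : 0 < fine (sigma K).
Proof. by rewrite -lte_fin spherical_measure_fineK. Qed.

Let norm_dotv_le u x : sphere n x -> `|(`|dotv u x|)| <= enorm u.
Proof. by move=> x1; rewrite normr_id; exact: ler_dotv_sphere. Qed.

Lemma integrable_norm_dotv u :
  sigma.-integrable K (EFin \o (fun x => `|dotv u x|)).
Proof. exact: (integrable_sphere _ _ (measurable_norm_dotv u) (norm_dotv_le u)). Qed.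

Lemma widthD_le u v : width K (u + v) <= width K u + enorm v * s.
Proof.
rewrite /width -(Rintegral_cst sigma mK) -RintegralD//; last 2 first.
- exact: integrable_norm_dotv.
- apply: (integrable_sphere (C := enorm v)) => //.
  by move=> x _; rewrite ger0_norm// enorm_ge0.
apply: le_Rintegral => //.
- exact: integrable_norm_dotv.
- apply: (integrable_sphere (C := enorm u + enorm v)) => //.
    by apply: measurable_funD => //; exact: measurable_norm_dotv.
  move=> x x1; rewrite ger0_norm ?addr_ge0 ?enorm_ge0//.
  by rewrite lerD2r; exact: ler_dotv_sphere.
move=> x /Ksph x1; rewrite dotvDl (le_trans (ler_normD _ _))// lerD2l.
exact: ler_dotv_sphere.
Qed.

Lemma widthZ a u : width K (a *: u) = `|a| * width K u.
Proof.
rewrite /width -RintegralZl//; last exact: integrable_norm_dotv.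
by apply: eq_Rintegral => x _; rewrite dotvZl normrM.
Qed.

Lemma width_continuous : continuous (width K).
Proof.
move=> u A /nbhs_ballP[eps /= eps0 uA].
have s0 := fine_spherical_measure_gt0.
apply/nbhs_enormP; exists (eps / s); first by rewrite divr_gt0.
move=> v; rewrite ltr_pdivlMr// => vu /=.
have H1 := widthD_le u (v - u); have H2 := widthD_le v (u - v).
rewrite !(addrC _ (_ - _)) !subrK in H1 H2.
have E : enorm (u - v) = enorm (v - u) by rewrite -enormN opprB.
apply: uA; rewrite /ball/= ltr_norml.
by apply/andP; split; rewrite E in H2; lra.
Qed.

Lemma strip_measurable u a : measurable [set x : V | `|dotv u x| <= a].
Proof.
rewrite -[X in measurable X]setTI.
rewrite (_ : [set _ | _] = (fun x => `|dotv u x|) @^-1` `]-oo, a]).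
  exact: measurable_norm_dotv.
by apply/seteqP; split => x /=; rewrite in_itv.
Qed.

(** Continuity from above: the strips decrease to a great subsphere, which is null. *)
Lemma strip_small u (eps : R) : u != 0 -> 0 < eps ->
  exists2 a, 0 < a & fine (sigma (K `&` [set x | `|dotv u x| <= a])) < eps.
Proof.
move=> u0 eps0.
pose F k := K `&` [set x : V | `|dotv u x| <= k.+1%:R^-1].
have mF k : measurable (F k) by apply: measurableI => //; exact: strip_measurable.
have FE : \bigcap_k F k = K `&` [set x | dotv u x = 0].
  apply/seteqP; split => x.
    move=> H; split; first by have [] := H 0%N I.
    apply/eqP; rewrite -normr_le0; apply/ler_addgt0Pr => t t0; rewrite add0r.
    have [k /= kt] := filter_ex (near_infty_natSinv_lt (PosNum t0)).
    by have [_ /= /le_trans] := H k I; apply; exact: ltW.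
  by move=> [Kx /= ux] k _; split => //=; rewrite ux normr0 invr_ge0.
have mH0 : measurable [set x : V | dotv u x = 0].
  exact: (measurable_dotv_set u (measurable_set1 (0 : R))).
have F0 : sigma (\bigcap_k F k) = 0%E.
  rewrite FE; apply/eqP; rewrite eq_le measure_ge0 andbT.
  rewrite -(spherical_measure_hyperplane u0).
  by apply: le_measure; rewrite ?inE//; exact: measurableI.
have : sigma \o F @ \oo --> sigma (\bigcap_k F k).
  apply: nonincreasing_cvg_mu => //.
  - exact: spherical_measure_lty.
  - by rewrite FE; exact: measurableI.
  - move=> k l kl; apply/subsetPset => x [Kx /= ux]; split => //=.
    by rewrite (le_trans ux)// lef_pV2 ?posrE// ler_nat.
rewrite F0 => /fine_cvgP[_] /cvgrPdist_lt/(_ _ eps0)[k _ /(_ k (leqnn k))].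
rewrite /= sub0r normrN ger0_norm ?fine_ge0// => kF.
by exists (k.+1%:R^-1); rewrite ?invr_gt0.
Qed.

(** Off a strip carrying less than half of the mass of [K] the integrand exceeds [a]. *)
Lemma width_gt0 u : u != 0 -> 0 < width K u.
Proof.
move=> u0; have s0 := fine_spherical_measure_gt0.
have [//|a a0 aK] := @strip_small u (s / 2) u0; first by rewrite divr_gt0.
have mS : measurable (K `&` [set x | `|dotv u x| <= a]).
  by apply: measurableI => //; exact: strip_measurable.
have mT : measurable (K `&` ~` [set x | `|dotv u x| <= a]).
  by apply: measurableI => //; apply: measurableC; exact: strip_measurable.
have KE : K = (K `&` [set x | `|dotv u x| <= a]) `|` (K `&` ~` [set x | `|dotv u x| <= a]).
  by rewrite -setIUr setUv setIT.
have sE : s = fine (sigma (K `&` [set x | `|dotv u x| <= a])) +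
    fine (sigma (K `&` ~` [set x | `|dotv u x| <= a])).
  rewrite -fineD ?ge0_fin_numE ?spherical_measure_lty//; congr fine.
  rewrite -measureU//; first by rewrite -KE.
  by rewrite setIACA setICr setI0.
apply: (@lt_le_trans _ _ (a * fine (sigma (K `&` ~` [set x | `|dotv u x| <= a])))).
  by rewrite mulr_gt0//; lra.
rewrite -Rintegral_cst// /width {2}KE Rintegral_setU//; last 2 first.
- by rewrite -KE; exact: integrable_norm_dotv.
- by apply/disj_setPS => x [[_ ?] [_]].
rewrite -[leLHS]add0r lerD//; first by apply: Rintegral_ge0 => x _.
apply: le_Rintegral => //.
- apply: (integrable_sphere (C := `|a|)) => //.
  by move=> x [/Ksph].
- apply: (@integrableS _ _ _ _ K) => //; exact: integrable_norm_dotv.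
- by move=> x [_ /= /negP]; rewrite -ltNge => /ltW.
Qed.

Lemma closed_sphere : closed (sphere n : set V).
Proof.
rewrite (_ : sphere n = (fun v : V => dotv v v) @^-1` [set 1]).
  apply: preimage_closed; first by move=> x _; exact: dotv_sqr_continuous.
  exact: closed_eq.
by apply/seteqP; split => x /sphereP.
Qed.

Lemma compact_sphere : compact (sphere n : set V).
Proof.
apply: bounded_closed_compact.
  exists 1; split; first exact: num_real.
  move=> M M1 x x1 /=; apply: (@le_trans _ _ 1); last exact: ltW.
  change (mx_norm x <= 1); rewrite mx_normrE; apply/bigmax_leP; split => // -[i j] _ /=.
  by rewrite (ord1 i) (le_trans (le_coord_enorm _ _))// x1.
exact: closed_sphere.
Qed.

(** Minimum over the compact sphere, extended by homogeneity. It later turns absolute errors into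
    relative ones. *)
Lemma width_lower : exists2 a, 0 < a & forall u, a * enorm u <= width K u.
Proof.
have S0 : (sphere n : set V) !=set0.
  exists (normalize (const_mx 1)); apply: sphere_normalize.
  by apply/eqP => /rowP/(_ ord0); rewrite !mxE; apply/eqP/oner_neq0.
have [|c c1 cmin] := @compact_EVT_min _ _ (width K) (sphere n) S0 compact_sphere.
  by apply: continuous_subspaceT; exact: width_continuous.
rewrite inE in c1.
exists (width K c); first by rewrite width_gt0// (sphere_neq0 c1).
move=> u; have [->|u0] := eqVneq u 0.
  by rewrite /enorm dotv0l sqrtr0 mulr0; apply: Rintegral_ge0.
rewrite -[u in leRHS]normalizeK widthZ ger0_norm ?enorm_ge0// mulrC.
rewrite ler_wpM2l ?enorm_ge0// cmin// inE.
exact: sphere_normalize.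
Qed.

Lemma Rintegral_le_indic D A g C C' : measurable D -> D `<=` K -> measurable A ->
  measurable_fun setT g -> (forall x, sphere n x -> `|g x| <= C') ->
  0 <= C -> (forall x, D x -> g x <= C * \1_A x) ->
  Rintegral sigma D g <= C * fine (sigma (K `&` A)).
Proof.
move=> mD DK mA mg gC' C0 gA.
have Ds : D `<=` sphere n by move=> x /DK/Ksph.
have iA : sigma.-integrable D (EFin \o (\1_A : V -> R)).
  apply: (integrable_sphere (C := 1)) => //.
  by move=> x _; rewrite ger0_norm// indicE; case: (_ \in _).
apply: (@le_trans _ _ (Rintegral sigma D (fun x => C * \1_A x))).
  apply: le_Rintegral => //; first exact: integrable_sphere mg gC'.
  exact: (integrableZl mD C iA).
rewrite RintegralZl// ler_wpM2l// /Rintegral integral_indic//.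
apply: fine_le.
- by rewrite ge0_fin_numE ?spherical_measure_lty//; exact: measurableI.
- by rewrite ge0_fin_numE ?spherical_measure_lty//; exact: measurableI.
- apply: le_measure; rewrite ?inE; [exact: measurableI|exact: measurableI|].
  by rewrite setIC => x [/DK].
Qed.

Variable e : V.
Hypothesis e1 : sphere n e.
Hypothesis Ksym : reflect_about e @` K = K.

(* The support function [width] is differentiable away from 0, with gradient
   twice the moment, because the strips [|u . x| <= a] have vanishing measure;
   this forces uniqueness of the touching point. *)
Lemma moment_extremal z u : u != 0 -> dotv u e = 0 ->
  (forall v, dotv v e = 0 -> dotv z v <= width K v) ->
  dotv z u = width K u ->
  forall v, dotv v e = 0 -> dotv z v = dotv (moment K u) v *+ 2.
Proof.
move=> u0 ue zw zu.
(* One inequality suffices: it is applied to -v as well. *)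
suff le_z v : dotv v e = 0 -> dotv z v <= dotv (moment K u) v *+ 2.
  move=> v ve; apply/eqP; rewrite eq_le le_z//=.
  have := le_z (- v); rewrite dotvNl ve oppr0 => /(_ erefl).
  by rewrite !dotvNr mulNrn lerN2.
move=> ve; apply/ler_addgt0Pr => eps eps0.
pose B := enorm v.
have B0 : 0 <= B := enorm_ge0 v.
have B1 : 0 < 4 * (B + 1) by rewrite mulr_gt0// ltr_wpDl.
(* The 4 collects two halves with an integrand of at most 2 t B each; the + 1 covers v = 0. *)
have [|a a0 aK] := @strip_small u (eps / (4 * (B + 1))) u0; first exact: divr_gt0.
pose S := [set x : V | `|dotv u x| <= a].
have mS : measurable S by exact: strip_measurable.
(* Small enough that t |v . x| <= a: off the strip, moving u by t v does not change the sign of u .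
   x. *)
pose t := a / (B + 1).
have t0 : 0 < t by rewrite divr_gt0// ltr_wpDl.
have tB : t * B <= a.
  by rewrite /t mulrAC ler_pdivrMr ?ltr_wpDl// ler_pM2l// lerDl.
have vx x : sphere n x -> `|t * dotv v x| <= t * B.
  by move=> x1; rewrite normrM gtr0_norm// ler_pM2l// ler_dotv_sphere.
clearbody t B.
pose w := u + t *: v.
have we : dotv w e = 0 by rewrite /w dotvDl dotvZl ue ve mulr0 addr0.
(* Both z and twice the moment attain the width at u, so their difference along v is controlled by
   the excess of [width] over the moment at w. *)
have key : t * (dotv z v - dotv (moment K u) v *+ 2) <= width K w - dotv (moment K u) w *+ 2.
  have := zw _ we; have := moment_width mK Ksph e1 Ksym u0 ue.
  rewrite /w !dotvE -zu !mulr2n => H; lra.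
(* By [E] below the excess is the integral of [half w] over the half of u plus that of [half (- w)]
   over the opposite half. There the integrands vanish off the strip and are at most 2 t B on it. *)
pose half y x := `|dotv w x| - dotv y x.
have mhalf y : measurable_fun setT (half y).
  by apply: measurable_funB; [exact: measurable_norm_dotv|exact: measurable_dotv].
have bhalf y x : sphere n x -> `|half y x| <= enorm w + enorm y.
  move=> x1; rewrite (le_trans (ler_normB _ _))// lerD//.
    exact: norm_dotv_le.
  exact: ler_dotv_sphere.
have Ks w' : K `&` hemisphere w' `<=` sphere n by move=> x [/Ksph].
have mKh w' : measurable (K `&` hemisphere w') by exact: measurable_hemisphere.
have bound w' y : (forall x, sphere n x -> 0 <= dotv w' x -> half y x <= (2 * (t * B)) * \1_S x) ->
  Rintegral sigma (K `&` hemisphere w') (half y) <= 2 * (t * B) * fine (sigma (K `&` S)).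
  move=> H; apply: (@Rintegral_le_indic (K `&` hemisphere w') S (half y) _
    (enorm w + enorm y) (mKh w') (@subIsetl _ _ _) mS (mhalf y) (bhalf y)).
    exact: mulr_ge0 (ler0n _ 2) (mulr_ge0 (ltW t0) B0).
  by move=> x [_ [x1 ?]]; exact: H.
have b1 : Rintegral sigma (K `&` hemisphere u) (half w) <= 2 * (t * B) * fine (sigma (K `&` S)).
  apply: bound => x x1 ux; rewrite /half indicE /w !dotvE.
  have := vx _ x1; rewrite ler_norml => /andP[v1 v2].
  have [xS|xS] := boolP (x \in S).
    rewrite mulr1; by case: ger0P => ?; lra.
  have : a < dotv u x.
    rewrite ltNge; apply: contra xS => xa; rewrite inE /S/= ger0_norm//.
  by move=> ?; rewrite mulr0 ger0_norm; lra.
have b2 : Rintegral sigma (K `&` hemisphere (- u)) (half (- w)) <=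
    2 * (t * B) * fine (sigma (K `&` S)).
  apply: bound => x x1; rewrite /half indicE /w !dotvE => ux.
  have := vx _ x1; rewrite ler_norml => /andP[v1 v2].
  have [xS|xS] := boolP (x \in S).
    rewrite mulr1; by case: ger0P => ?; lra.
  have : a < - dotv u x.
    rewrite ltNge; apply: contra xS => xa; rewrite inE /S/= ler0_norm//.
    by rewrite -oppr_ge0.
  by move=> ?; rewrite mulr0 ler0_norm; lra.
have E : width K w - dotv (moment K u) w *+ 2 =
  Rintegral sigma (K `&` hemisphere u) (half w) +
  Rintegral sigma (K `&` hemisphere (- u)) (half (- w)).
  rewrite (moment_orth mK Ksph e1 Ksym)// /width.
  rewrite (Rintegral_hemispheres mK Ksph u0 (measurable_norm_dotv w) (norm_dotv_le w)).
  rewrite /half !RintegralB//; first by rewrite addrACA opprD.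
  - exact: (integrable_sphere _ _ (measurable_norm_dotv w) (norm_dotv_le w)).
  - exact: (integrable_sphere _ _ (measurable_dotv (- w)) (@ler_dotv_sphere _ _ (- w))).
  - exact: (integrable_sphere _ _ (measurable_norm_dotv w) (norm_dotv_le w)).
  - exact: (integrable_sphere _ _ (measurable_dotv w) (@ler_dotv_sphere _ _ w)).
have f0 : 0 <= fine (sigma (K `&` S)) by rewrite fine_ge0.
rewrite E in key.
have {key b1 b2 E} key : t * (dotv z v - dotv (moment K u) v *+ 2) <=
    t * (4 * B * fine (sigma (K `&` S))).
  by lra.
rewrite ler_pM2l// in key.
rewrite ltr_pdivlMr// in aK.
have {}aK : fine (sigma (K `&` S)) * (4 * (B + 1)) < eps by exact: aK.
by nra.
Qed.

End width.

(** * Spherical convexity *)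

Section spherical_convexity.
Context {R : realType} (n : nat).
Local Notation V := 'rV[R]_n.+1.
Implicit Types (A B C D G : set V) (u v w x y e : V) (a r t : R).

Lemma coneZ A a x : 0 <= a -> cone A x -> cone A (a *: x).
Proof.
move=> a0 [l /= l0 [u Au <-]]; exists (a * l) => /=; first exact: mulr_ge0.
by exists u => //; rewrite scalerA.
Qed.

Lemma sub_cone A : A `<=` cone A.
Proof. by move=> x Ax; exists 1 => /=; [exact: ler01|exists x => //; rewrite scale1r]. Qed.

(** Convexity yields the midpoint, and a cone is closed under doubling. *)
Lemma coneD A x y : sconvex A -> cone A x -> cone A y -> cone A (x + y).
Proof.
move=> [_ cA] Ax Ay.
have h01 : (0 <= (2^-1 : R) <= 1) by apply/andP; split; lra.
have := cA x y (Itv01 (proj1 (andP h01)) (proj2 (andP h01))).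
rewrite !inE => /(_ Ax Ay) /(coneZ (ler0n R 2)).
congr (cone A _).
rewrite /conv/= /onem scalerDr !scalerA.
have -> : (2 : R) * 2^-1 = 1 by rewrite divff.
by have -> : (2 : R) * (1 - 2^-1) = 1; [field|rewrite !scale1r].
Qed.

Lemma cone_normalize A x : A `<=` sphere n -> x != 0 -> cone A x -> A (normalize x).
Proof.
move=> As x0 [l /= l0 [u Au lu]].
have l1 : 0 < l.
  by rewrite lt_neqAle l0 andbT; apply: contra_neq x0 => l00; rewrite -lu -l00 scale0r.
by rewrite -lu normalizeZ// normalize_sphere//; exact: As.
Qed.

Lemma cone_sphere A x : A `<=` sphere n -> sphere n x -> cone A x -> A x.
Proof.
by move=> As x1 /cone_normalize; rewrite normalize_sphere//; apply=> //; exact: sphere_neq0.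
Qed.

Lemma normalize_cone A x : cone A (normalize x) -> cone A x.
Proof. by move=> /(coneZ (enorm_ge0 x)); rewrite normalizeK. Qed.

Lemma sconvex_cone (P : V -> Prop) :
  (forall a x, 0 <= a -> P x -> P (a *: x)) ->
  (forall x y, P x -> P y -> P (x + y)) ->
  sconvex (sphere n `&` P).
Proof.
move=> PZ PD; split; first by move=> x [].
move=> _ _ p /set_mem[l /= l0 [u [u1 Pu] <-]] /set_mem[m /= m0 [v [v1 Pv] <-]].
apply/mem_set; rewrite /conv/=.
set w := _ + _.
have Pw : P w.
  apply: PD; apply: (PZ); try exact: PZ; first exact: ge0.
  by rewrite onem_ge0// le1.
(* The combination may vanish and then has no direction; 0 is the apex of the cone over any
   point. *)
have [w0|w0] := eqVneq w 0.
  by exists 0 => //=; exists u => //; rewrite w0 scale0r.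
exists (enorm w) => /=; first exact: enorm_ge0.
exists (normalize w); last exact: normalizeK.
split; first exact: sphere_normalize.
by apply: PZ => //; rewrite invr_ge0 enorm_ge0.
Qed.

Lemma sconv_sub A C : sconvex C -> A `<=` C -> sconv A `<=` C.
Proof. by move=> cC AC x; apply. Qed.

Lemma sboundaryP A x : A `<=` sphere n -> closed A ->
  sboundary A x <-> A x /\ forall r, 0 < r ->
    exists y, [/\ sphere n y, enorm (y - x) < r & ~ A y].
Proof.
move=> As cA; split=> [[clx nix]|[Ax H]].
  have Ax : A x.
    apply: contrapT => nAx; have [x1|nx1] := pselect (sphere n x).
      have : @nbhs _ (subspace (sphere n : set V)) x (~` A).
        change (nbhs_subspace (x : subspace (sphere n : set V)) (~` A)).
        rewrite -nbhs_subspace_in// /within/=.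
        apply: (@filterS _ (nbhs x) _ (~` A)); first by move=> y.
        by apply: open_nbhs_nbhs; split => //; exact: closed_openC.
      by move=> /clx[y [? ?]].
    (* Points off the sphere are isolated in the [subspace] topology. *)
    have : @nbhs _ (subspace (sphere n : set V)) x [set x].
      change (nbhs_subspace (x : subspace (sphere n : set V)) [set x]).
      by rewrite -nbhs_subspace_out.
    by move=> /clx[y [/= Ay yx]]; apply: nAx; rewrite -yx.
  split => // r r0; apply: contrapT => H; apply: nix.
  apply/(sinteriorP _ (As _ Ax)); exists r => // y y1 yx.
  by apply: contrapT => nAy; apply: H; exists y.
split; first exact: (@subset_closure (subspace (sphere n)) A).
move=> /(sinteriorP _ (As _ Ax))[r r0 rA].
by have [y [y1 yx]] := H _ r0; apply; exact: rA.
Qed.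

Lemma compact_subsphere A : A `<=` sphere n -> closed A -> compact A.
Proof. by move=> As cA; apply: subclosed_compact As => //; exact: compact_sphere. Qed.

Lemma closed_enormP A x : closed A ->
  (forall r, 0 < r -> exists2 y, A y & enorm (y - x) < r) -> A x.
Proof.
move=> cA H; apply: cA => B /nbhs_enormP[r r0 rB].
by have [y Ay yx] := H _ r0; exists y; split => //; exact: rB.
Qed.

(* A ray leaving a body contained in an open hemisphere must cross its
   boundary: it stays at constant height over the equator, whereas the body
   stays away from the equator by compactness. *)
Lemma exit_boundary G u x y : closed G -> G `<=` open_hemisphere u ->
  G x -> dotv u y = 0 -> y != 0 ->
  exists2 t, 0 <= t & sboundary G (normalize (x + t *: y)).
Proof.
move=> cG Gu Gx uy y0.
have Gs : G `<=` sphere n by move=> z /Gu[].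
have [|g Gg gmin] := @compact_EVT_min _ _ (dotv u) G (ex_intro _ x Gx) (compact_subsphere Gs cG).
  by apply: continuous_subspaceT; exact: dotv_continuous.
rewrite inE in Gg; have [_ g0] := Gu _ Gg.
have ux : 0 < dotv u x by case: (Gu _ Gx).
have uxy t : dotv u (x + t *: y) = dotv u x by rewrite !dotvE uy mulr0 addr0.
have nz t : x + t *: y != 0.
  by apply/eqP => E; move: (uxy t) ux; rewrite E dotv0r => <-; rewrite ltxx.
pose S := [set t : R | 0 <= t /\ G (normalize (x + t *: y))].
have S0 : S 0 by split => //; rewrite scale0r addr0 normalize_sphere//; exact: Gs.
have ny : 0 < enorm y by rewrite enorm_gt0.
have hsS : has_sup S.
  split; first by exists 0.
  (* The height of x + t y is constant while that of its normalisation is at least [dotv u g], so |x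
     + t y| is bounded, and with it t. *)
  exists ((dotv u x / dotv u g + 1) / enorm y) => t [t0 Gt].
  rewrite ler_pdivlMr//.
  have H1 : enorm (x + t *: y) * dotv u g <= dotv u x.
    rewrite -(uxy t) -[x + t *: y in leRHS]normalizeK dotvZr.
    by rewrite ler_wpM2l ?enorm_ge0// gmin// inE.
  rewrite -ler_pdivlMr// in H1.
  have := enormD (x + t *: y) (- x); rewrite addrAC subrr add0r.
  by rewrite enormN enormZ ger0_norm// (Gs _ Gx : enorm x = 1); lra.
pose s := sup S.
have s0 : 0 <= s by exact: ub_le_sup hsS.2 _ S0.
(* A Lipschitz bound at s: it makes the normalised ray at the supremum a limit of points of [G] and
   also of points outside [G]. *)
have lip t : enorm (normalize (x + t *: y) - normalize (x + s *: y)) <=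
    2 * (enorm (x + s *: y))^-1 * enorm y * `|t - s|.
  rewrite (le_trans (normalize_lipschitz (nz s) (nz t)))// -!mulrA.
  rewrite (_ : x + t *: y - _ = (t - s) *: y) ?enormZ; last first.
    by rewrite opprD addrACA subrr add0r scalerBl.
  by rewrite (mulrC _ (enorm y)).
pose c := 2 * (enorm (x + s *: y))^-1 * enorm y.
have c0 : 0 < c by rewrite !mulr_gt0// invr_gt0 enorm_gt0.
exists s => //; apply/sboundaryP => //; split.
  apply: closed_enormP => // r r0.
  have rc : 0 < r / c by rewrite divr_gt0.
  have [t [t0 Gt] st] := sup_adherent rc hsS.
  exists (normalize (x + t *: y)) => //.
  have ts : t <= s by apply: ub_le_sup hsS.2 _ _.
  apply: le_lt_trans (lip t) _; rewrite -/c -ltr_pdivlMl// mulrC.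
  by rewrite ler0_norm ?subr_le0// opprB -/s in st *; lra.
move=> r r0; pose t := s + r / c / 2.
have rc : 0 < r / c / 2 by rewrite !divr_gt0.
exists (normalize (x + t *: y)); split.
- exact: sphere_normalize.
- apply: le_lt_trans (lip t) _; rewrite -/c -ltr_pdivlMl// mulrC /t.
  by rewrite addrAC subrr add0r gtr0_norm//; lra.
- move=> Gt; have : t <= s.
    by apply: ub_le_sup hsS.2 _ _; split => //; rewrite /t addr_ge0// ltW.
  by rewrite /t; lra.
Qed.

(** In a direction y orthogonal to u the ray from x leaves [G] both ways, so x is a nonnegative
    combination of two boundary points. Thus the boundary determines the body. *)
Lemma proper_convex_bodyE G : (0 < n)%N -> proper_convex_body G ->
  G = sconv (sboundary G).
Proof.
move=> n0 [[[Gs cvG] cG GT Gi] [u u1 Gu]].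
have bG : sboundary G `<=` G by move=> x /sboundaryP[].
apply/seteqP; split; last by apply: sconv_sub.
move=> x Gx C [cC bC].
have [y y1 yu] := exists_orth u n0.
have y0 := sphere_neq0 y1.
rewrite dotvC in yu.
have [s s0 bs] := exit_boundary cG Gu Gx yu y0.
have [t t0 bt] : exists2 t, 0 <= t & sboundary G (normalize (x + t *: - y)).
  by apply: exit_boundary cG Gu Gx _ _; rewrite ?oppr_eq0// dotvNr yu oppr0.
have Cs := normalize_cone (sub_cone (bC _ bs)).
have Ct := normalize_cone (sub_cone (bC _ bt)).
have Gxs := Gs _ Gx.
apply: (cone_sphere cC.1 Gxs).
(* If s + t = 0 then x is itself a boundary point. *)
have [st0|st0] := eqVneq (s + t) 0.
  have s00 : s = 0 by lra.
  by move: Cs; rewrite s00 scale0r addr0.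
have st : 0 < s + t by rewrite lt_neqAle eq_sym st0 addr_ge0.
have := coneD cC (coneZ t0 Cs) (coneZ s0 Ct).
have -> : t *: (x + s *: y) + s *: (x + t *: - y) = (s + t) *: x.
  by apply/rowP => i; rewrite !mxE; ring.
move=> /(coneZ (ltW (_ : 0 < (s + t)^-1))); rewrite invr_gt0 => /(_ st).
by rewrite scalerA mulVf// scale1r.
Qed.

End spherical_convexity.

(** * The centroid body *)

Section support_body.
Context {R : realType} (n : nat).
Local Notation V := 'rV[R]_n.+1.
Implicit Types (A B C D G : set V) (u v w x y : V) (a r t : R).
Variable e : V.
Hypothesis e1 : sphere n e.
Let ee : dotv e e = 1. Proof. exact/sphereP. Qed.

(* In gnomonic coordinates at [e]: the convex body with support function
   [W / c] in the tangent space [e^perp]. *)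
Definition support_body (W : V -> R) (c : R) : set V :=
  sphere n `&` [set x | 0 <= dotv x e /\
    forall u, dotv u e = 0 -> c * dotv x u <= dotv x e * W u].

Lemma support_body_sconvex W c : sconvex (support_body W c).
Proof.
apply: sconvex_cone => [a x a0 [xe xW]|x y [xe xW] [ye yW]].
  split; first by rewrite dotvZl mulr_ge0.
  by move=> u ue; rewrite !dotvZl mulrCA -mulrA ler_wpM2l// xW.
split; first by rewrite dotvDl addr_ge0.
by move=> u ue; rewrite !dotvDl mulrDr mulrDl lerD// ?xW ?yW.
Qed.

Lemma support_body_closed W c : closed (support_body W c).
Proof.
apply: closedI; first exact: closed_sphere.
rewrite (_ : [set _ | _] = [set x | dotv x 0 <= dotv x e] `&`
  \bigcap_(u in [set u | dotv u e = 0]) [set x | dotv x (c *: u) <= dotv x (W u *: e)]).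
  apply: closedI; first exact: closed_dotv_ge.
  by apply: closed_bigI => u _; exact: closed_dotv_ge.
apply/seteqP; split => x /=; rewrite dotv0r => -[xe xW]; split => // u ue.
  by rewrite /= !dotvZr (mulrC (W u)) xW.
by have := xW _ ue; rewrite /= !dotvZr (mulrC (W u)).
Qed.

Variables (W : V -> R) (c d : R).
Hypotheses (c0 : 0 < c) (d0 : 0 < d).
Hypothesis Wd : forall u, d * enorm u <= W u.
Hypothesis WZ : forall a u, W (a *: u) = `|a| * W u.
Hypothesis Wc : continuous W.

Lemma support_body_pos : support_body W c `<=` open_hemisphere e.
Proof.
move=> x [x1 [xe xW]]; split => //; rewrite dotvC lt_neqAle xe andbT.
apply/eqP => xe0; have := xW x; rewrite -xe0 mul0r (sphereP _).1// mulr1.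
by move=> /(_ erefl); rewrite leNgt c0.
Qed.

Lemma support_body_proper : proper_convex_body (support_body W c).
Proof.
split; last by exists e => //; exact: support_body_pos.
split.
- exact: support_body_sconvex.
- exact: support_body_closed.
- move=> E; have : support_body W c (- e).
    by rewrite E /sphere/= enormN.
  by move=> /support_body_pos[_]; rewrite dotvNr ee ltr0N1.
(* The radius r solves c r = (1 - r) d: then c (y . u) <= c r |u|, while (y . e) W(u) >= (1 - r) d
   |u|. *)
- exists e; apply/sinteriorP => //; exists (d / (c + d)).
    by rewrite divr_gt0// addr_gt0.
  move=> y y1 ye; split => //.
  have cd : 0 < c + d by rewrite addr_gt0.
  have H w : `|dotv (y - e) w| <= d / (c + d) * enorm w.
    by rewrite (le_trans (ler_dotv _ _))// ler_wpM2r ?enorm_ge0// ltW.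
  have ye0 : c / (c + d) <= dotv y e.
    have := H e; rewrite e1 mulr1 dotvBl ee ler_norml => /andP[H1 _].
    have -> : c / (c + d) = 1 - d / (c + d) by field; rewrite gt_eqF.
    by lra.
  split; first by rewrite (le_trans _ ye0)// divr_ge0// ltW.
  move=> u ue; have := H u; rewrite dotvBl (dotvC e) ue subr0 ler_norml => /andP[_ H1].
  apply: (@le_trans _ _ (c * (d / (c + d) * enorm u))).
    by rewrite ler_pM2l.
  apply: (@le_trans _ _ (c / (c + d) * W u)).
    rewrite (_ : _ * _ = c / (c + d) * (d * enorm u)); last by ring.
    by rewrite ler_wpM2l// divr_ge0// ltW.
  by rewrite ler_wpM2r// (le_trans _ (Wd u))// mulr_ge0 ?enorm_ge0// ltW.
Qed.

(** If a constraint is tight, moving x towards u violates it. If none is, compactness of the unit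
    directions orthogonal to [e] bounds the slack from below, and a whole neighbourhood of x
    satisfies the constraints. *)
Lemma support_body_boundary x : (0 < n)%N ->
  sboundary (support_body W c) x <->
  support_body W c x /\
  exists u, [/\ sphere n u, dotv u e = 0 & c * dotv x u = dotv x e * W u].
Proof.
move=> n0; have Gs : support_body W c `<=` sphere n by move=> y [].
have cG := @support_body_closed W c.
split=> [/(sboundaryP _ Gs cG)[Gx H]|[Gx [u [u1 ue E]]]]; last first.
  apply/(sboundaryP _ Gs cG); split => // r r0.
  have [x1 [xe xW]] := Gx.
  (* A quarter, because normalising may double the distance. *)
  pose t := r / 4; have t0 : 0 < t by rewrite divr_gt0.
  have vu : c * dotv (x + t *: u) u > dotv (x + t *: u) e * W u.
    rewrite !dotvDl !dotvZl ue mulr0 addr0 -E mulrDr ltrDl (sphereP _).1// mulr1.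
    exact: mulr_gt0.
  have v0 : x + t *: u != 0.
    by apply/eqP => v0; move: vu; rewrite v0 !dotv0l mul0r mulr0 ltxx.
  exists (normalize (x + t *: u)); split; first exact: sphere_normalize.
    rewrite (le_lt_trans (normalize_close x1 v0))//.
    by rewrite addrAC subrr add0r enormZ gtr0_norm// u1 mulr1 /t; lra.
  move=> [_ [_ /(_ u ue)]].
  rewrite /normalize !dotvZl mulrCA -mulrA.
  by rewrite ler_pM2l ?invr_gt0 ?enorm_gt0// leNgt vu.
split=> //; apply: contrapT => nu.
have [x1 [_ xW]] := Gx; have [_ xe] := support_body_pos Gx; rewrite dotvC in xe.
pose S : set V := sphere n `&` [set u | dotv u e = 0].
have cS : compact S.
  apply: compact_subsphere; first by move=> u [].
  apply: closedI; first exact: closed_sphere.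
  rewrite (_ : [set _ | _] = dotv e @^-1` [set 0]).
    by apply: preimage_closed; [move=> v _; exact: dotv_continuous|exact: closed_eq].
  by apply/seteqP; split => v /=; rewrite dotvC.
have S0 : S !=set0 by have [u u1 ue] := exists_orth e n0; exists u.
pose F u := dotv x e * W u - c * dotv x u.
have cF : continuous F.
  move=> u; rewrite /F; apply: (@continuousB _ _ _
    (fun u => dotv x e * W u) (fun u => c * dotv x u)).
    by apply: continuousM; [exact: cst_continuous|exact: Wc].
  by apply: continuousM; [exact: cst_continuous|exact: dotv_continuous].
have [|f Sf fmin] := @compact_EVT_min _ _ F S S0 cS.
  by apply: continuous_subspaceT; exact: cF.
have [|g Sg gmax] := @compact_EVT_max _ _ W S S0 cS.
  by apply: continuous_subspaceT; exact: Wc.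
rewrite inE in Sf; rewrite inE in Sg.
have F0 : 0 < F f.
  rewrite subr_gt0 lt_neqAle xW ?andbT; last by case: Sf.
  by apply/eqP => E; apply: nu; exists f; case: Sf.
have Wg : 0 < W g.
  by rewrite (lt_le_trans _ (Wd g))// mulr_gt0// Sg.1.
have Wg0 : 0 < W g + c by rewrite addr_gt0.
(* A move by r changes the two sides of a constraint by at most c r and r W(g), which the least
   slack [F f] absorbs. *)
have [r [r0 rF re]] : exists r : R, [/\ 0 < r, r * (W g + c) <= F f & r <= dotv x e].
  exists (Num.min (F f / (W g + c)) (dotv x e)).
  rewrite lt_min divr_gt0// xe; split => //; last by rewrite ge_min lexx orbT.
  by rewrite -ler_pdivlMr// ge_min lexx.
have [y [y1 yx nGy]] := H _ r0; apply: nGy; split => //.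
have D w : sphere n w -> `|dotv (y - x) w| <= r.
  by move=> w1; rewrite (le_trans (ler_dotv _ _))// w1 mulr1 ltW.
have ye : 0 <= dotv y e.
  by have := D _ e1; rewrite dotvBl ler_norml => /andP[? _]; lra.
split => // u ue; have [->|u0] := eqVneq u 0.
  rewrite dotv0r mulr0 mulr_ge0// (le_trans _ (Wd 0))// mulr_ge0 ?enorm_ge0//.
  exact: ltW.
have Sv : S (normalize u).
  by split; [exact: sphere_normalize|rewrite /= /normalize dotvZl ue mulr0].
suff : c * dotv y (normalize u) <= dotv y e * W (normalize u).
  rewrite -[u in X in _ -> X]normalizeK WZ dotvZr (ger0_norm (enorm_ge0 u)).
  rewrite !(mulrCA _ (enorm u)) ler_pM2l// enorm_gt0//.
move: (normalize u) Sv => v Sv.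
have /= Fv := fmin _ (mem_set Sv); have /= Wv := gmax _ (mem_set Sv).
have W0 : 0 <= W v by rewrite (le_trans _ (Wd v))// mulr_ge0 ?enorm_ge0// ltW.
have := D _ Sv.1; rewrite dotvBl ler_norml => /andP[_ Dv].
have := D _ e1; rewrite dotvBl ler_norml => /andP[De _].
have K1 : c * (dotv y v - dotv x v) <= c * r by rewrite ler_pM2l.
have K2 : - (r * W g) <= (dotv y e - dotv x e) * W v.
  apply: (@le_trans _ _ (- r * W v)); last exact: ler_wpM2r.
  by rewrite mulNr lerN2 ler_pM2l.
by rewrite /F in Fv rF; lra.
Qed.

End support_body.

(** * Identification of the centroid body with a support body *)

Section centroid_body.
Context {R : realType} (n : nat).
Local Notation V := 'rV[R]_n.+1.
Local Notation sigma := (@spherical_measure R n).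
Variables (K : set V) (e : V).
Hypotheses (n0 : (0 < n)%N) (mK : measurable K) (Ksph : K `<=` sphere n).
Hypothesis K0 : (0 < sigma K)%E.
Hypothesis e1 : sphere n e.
Hypothesis Ksym : centrally_symmetric K e.

(** [get] needs a candidate, which the support body is by [G0b]; whatever [get] returns has the same
    boundary and is the hull of it. *)
Lemma centroid_bodyE : centroid_body K e = support_body e (width K) (width K e).
Proof.
have [Krefl Khemi] := Ksym.
set c := width K e; set G0 := support_body _ _ _.
have e0 := sphere_neq0 e1.
have c0 : 0 < c by exact: width_gt0.
have [d d0 dW] := width_lower mK Ksph K0.
have WZ := widthZ mK Ksph.
have Wc := width_continuous mK Ksph K0.
have G0p : proper_convex_body G0 by exact: support_body_proper d0 dW.
have orth_dec (x : V) : dotv (x - dotv x e *: e) e = 0.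
  by rewrite dotvBl dotvZl (sphereP _).1// mulr1 subrr.
have G0b : sboundary G0 = [set centroid (K `&` hemisphere u) | u in great_subsphere e].
  apply/seteqP; split => x.
    move=> /(support_body_boundary e1 c0 d0 dW WZ Wc _ n0)[Gx [u [u1 ue E]]].
    have [x1 [_ xW]] := Gx.
    have [_ xe] := support_body_pos c0 Gx; rewrite dotvC in xe.
    exists u; first by split; rewrite // dotvC.
    have u0 := sphere_neq0 u1.
    (* Rescaled to the height of twice the moment; [moment_extremal] then fixes the component
       orthogonal to [e]. *)
    pose z := (c / dotv x e) *: x.
    have zE v : dotv z v = (c * dotv x v) / dotv x e.
      by rewrite /z dotvZl mulrAC.
    have zm := @moment_extremal _ _ K mK Ksph e e1 Krefl z u u0 ue.
    have {}zm v : dotv v e = 0 -> dotv z v = dotv (moment K u) v *+ 2.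
      apply: zm.
        by move=> w we; rewrite zE ler_pdivrMr// [leRHS]mulrC xW.
      by rewrite zE E mulrC mulKf// gt_eqF.
    have zme : dotv z e = dotv (moment K u) e *+ 2.
      by rewrite zE mulfK ?gt_eqF// (moment_center mK Ksph e1 Krefl Khemi).
    have zE2 : z = 2 *: moment K u.
      apply/eqP; rewrite -subr_eq0 -dotv_eq0; set w := z - _.
      have wv v : dotv v e = 0 -> dotv w v = 0.
        by move=> ve; rewrite /w dotvBl dotvZl zm// mulr2n; ring.
      have we : dotv w e = 0 by rewrite /w dotvBl dotvZl zme mulr2n; ring.
      (* w is orthogonal to everything orthogonal to [e], in particular to itself. *)
      by rewrite wv.
    rewrite /centroid -/(moment K u) -(normalizeZ _ (ltr0n R 2)) -zE2.
    by rewrite normalizeZ ?divr_gt0// normalize_sphere.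
  move=> [u [u1 eu] <-]; rewrite dotvC in eu.
  have u0 := sphere_neq0 u1.
  rewrite /centroid -/(moment K u).
  have me := moment_center mK Ksph e1 Krefl Khemi u0 eu.
  have mu := moment_width mK Ksph e1 Krefl u0 eu.
  have me0 : 0 < dotv (moment K u) e.
    by rewrite -(@pmulrn_lgt0 _ _ 2)// me.
  have m0 : moment K u != 0.
    by apply: contraTneq me0 => ->; rewrite dotv0l ltxx.
  have nm : 0 < (enorm (moment K u))^-1 by rewrite invr_gt0 enorm_gt0.
  apply/(support_body_boundary e1 c0 d0 dW WZ Wc _ n0); split.
    split; first exact: sphere_normalize.
    split; first by rewrite /normalize dotvZl mulr_ge0// ltW.
    move=> v ve; rewrite /normalize !dotvZl mulrCA -mulrA ler_pM2l//.
    rewrite /c -me mulrnAl -mulrnAr ler_pM2l//.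
    exact: (moment_le_width mK Ksph e1 Krefl).
  exists u; split => //.
  by rewrite /normalize !dotvZl -mu mulrnAr /c -me mulrnAl mulrCA mulrA.
rewrite /centroid_body.
set P := [set G | _].
have /getPex[Gp Gb] : exists G, P G by exists G0.
by rewrite (proper_convex_bodyE n0 Gp) Gb -G0b -proper_convex_bodyE.
Qed.

End centroid_body.

(** The first-order condition at a nearest point, before cancelling the step length l. *)
Lemma dotv_perturb_le (R : realType) m (a b : 'rV[R]_m) l :
  dotv a a <= dotv (a - l *: b) (a - l *: b) ->
  l * (2 * dotv a b) <= l * (l * dotv b b).
Proof. by rewrite !dotvE (dotvC b a); lra. Qed.

(** * The discrete centroid body *)

Section zonotope.
Context {R : realType} (n N : nat).
Local Notation V := 'rV[R]_n.+1.
Variable w : 'I_N -> V.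

Definition zono (s : 'I_N -> R) : V := \sum_(i < N) s i *: w i.

(* The nearest point of the zonotope to [z] is [z] itself, otherwise the
   direction towards [z] would separate them. *)
Lemma zono_support (E : set V) (z : V) :
  (forall x y a, E x -> E y -> E (x + a *: y)) -> E z -> (forall i, E (w i)) ->
  (forall u, E u -> dotv z u <= \sum_(i < N) `|dotv (w i) u|) ->
  exists2 s : 'I_N -> R, (forall i, -1 <= s i <= 1) & z = zono s.
Proof.
move=> EZ Ez Ew zE.
(* A compact cube parametrises the zonotope, so a nearest point exists. *)
pose B : set 'rV[R]_N := [set s | forall i, `[-1, 1]%classic (s ord0 i)].
have cB : compact B 
  by apply: (@rV_compact R N (fun=> `[-1, 1]%classic)) => i; exact: segment_compact.
have B0 : B !=set0.
  by exists 0 => i; rewrite /= mxE in_itv/=; apply/andP; split; rewrite ?lerN10 ?ler01.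
pose F j (s : 'rV[R]_N) := z 0 j - \sum_(i < N) s 0 i * w i 0 j.
pose f (s : 'rV[R]_N) := \sum_(j < n.+1) F j s * F j s.
have cF j : continuous (F j).
  move=> s; apply: (@continuousB _ _ _
    (fun=> z 0 j) (fun s : 'rV[R]_N => \sum_(i < N) s 0 i * w i 0 j)).
    exact: cst_continuous.
  apply: continuous_sum => i {}s; apply: continuousM; last exact: cst_continuous.
  exact: coord_continuous.
have cf : continuous f.
  by apply: continuous_sum => j s; apply: continuousM; exact: cF.
have [|s Bs smin] := @compact_EVT_min _ _ f B B0 cB.
  by apply: continuous_subspaceT; exact: cf.
rewrite inE in Bs.
have fE t : f t = dotv (z - zono (fun i => t 0 i)) (z - zono (fun i => t 0 i)).
  apply: eq_bigr => j _; suff -> : F j t = (z - zono (fun i => t 0 i)) 0 j by [].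
  by rewrite /F /zono !mxE summxE; congr (_ - _); apply: eq_bigr => i _; rewrite mxE.
exists (fun i => s 0 i).
  by move=> i; have := Bs i; rewrite /= in_itv.
set p := zono _; set d := z - p.
have Ep : E p.
  rewrite /p /zono; elim/big_rec : _ => [|i x _ Ex].
    by rewrite -(addrN z) -scaleN1r; exact: EZ.
  by rewrite addrC; exact: EZ.
have Ed : E d by rewrite /d -scaleN1r; exact: EZ.
(* These signs make q the vertex farthest in direction d. *)
pose s' i : R := if 0 <= dotv (w i) d then 1 else -1.
pose q := zono s'.
have dq : dotv d q = \sum_(i < N) `|dotv (w i) d|.
  rewrite /q /zono dotv_sumr; apply: eq_bigr => i _.
  rewrite dotvZr dotvC /s'; case: ger0P => _; by rewrite ?mul1r ?mulN1r.
(* As d . q is the value of the support function at d, z . d <= d . q and hence |d|^2 <= d . (q -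
   p). *)
suff le0 : dotv d (q - p) <= 0.
  have d0 : dotv d d <= 0.
    have zd := zE _ Ed; rewrite dotvBr dq in le0.
    by rewrite {2}/d dotvBr (dotvC d z); lra.
  apply/eqP; rewrite -subr_eq0 -/d -dotv_eq0.
  by rewrite eq_le d0 dotv_ge0.
apply/ler_addgt0Pr => eps eps0; rewrite add0r.
pose D := dotv (q - p) (q - p).
have D0 : 0 <= D by exact: dotv_ge0.
have [l [l0 l1 lD]] : exists l : R, [/\ 0 < l, l <= 1 & l * D <= eps].
  exists (Num.min 1 (eps / (D + 1))).
  have D1 : 0 < D + 1 by rewrite ltr_wpDl.
  rewrite lt_min ltr01 divr_gt0// ge_min lexx; split => //.
  apply: (@le_trans _ _ (eps / (D + 1) * D)).
    by rewrite ler_wpM2r// ge_min lexx orbT.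
  by rewrite mulrAC ler_pdivrMr// ler_pM2l// lerDl.
(* Moving from p towards q by the fraction l stays in the zonotope; minimality gives 2 d . (q - p)
   <= l D <= eps. *)
pose t : 'rV[R]_N := \row_i (s 0 i + l * (s' i - s 0 i)).
have Bt : B t.
  move=> i; have := Bs i; rewrite /= !mxE !in_itv/= /s' => /andP[? ?].
  by case: ifP => _; apply/andP; split; nra.
have tE : z - zono (fun i => t 0 i) = d - l *: (q - p).
  rewrite /d -addrA; congr (_ + _); rewrite -opprD; congr (- _).
  rewrite /p /q /zono -sumrB scaler_sumr -big_split/=.
  by apply: eq_bigr => i _; rewrite mxE scalerDl -scalerA scalerBl.
have := smin _ (mem_set Bt); rewrite !fE tE -/p -/d /= => H.
have {}H : l * (2 * dotv d (q - p)) <= l * (l * D) by exact: dotv_perturb_le.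
by rewrite ler_pM2l// in H; lra.
Qed.

End zonotope.

Section discrete_body.
Context {R : realType} (n N : nat).
Local Notation V := 'rV[R]_n.+1.
Variables (e : V) (u : 'I_N -> V).
Hypothesis e1 : sphere n e.
Let T : R := \sum_(i < N) dotv (u i) e.
Let h (v : V) : R := \sum_(i < N) `|dotv (u i) v|.
Hypothesis T0 : 0 < T.

Let orth i := u i - dotv (u i) e *: e.

Lemma pointE (s : 'I_N -> R) : T *: e + zono orth s =
  \sum_(i < N) (dotv (u i) e *: e + s i *: orth i).
Proof. by rewrite big_split/= /T scaler_suml. Qed.

(** The coefficients are moved to the ends of [-1, 1] one at a time; in [H] those from k on are
    already there. A choice of signs is a choice between u_i and its reflection, because these are
    (u_i . e) e plus or minus [orth i]. *)
Lemma cone_vertices (C : set V) : sconvex C ->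
  [set centroid_points v | v in
    [set v : 'I_N -> V | forall i, v i = u i \/ v i = reflect_about e (u i)]] `<=` C ->
  forall s : 'I_N -> R, (forall i, -1 <= s i <= 1) -> cone C (T *: e + zono orth s).
Proof.
move=> cC sC.
suff H k : (k <= N)%N -> forall s : 'I_N -> R, (forall i, -1 <= s i <= 1) ->
    (forall i : 'I_N, (k <= i)%N -> s i = 1 \/ s i = -1) -> cone C (T *: e + zono orth s).
  by move=> s s1; apply: (H N) => // i; rewrite leqNgt ltn_ord.
elim: k => [|k IH] kN s s1 sk.
  apply: normalize_cone; apply: sub_cone; apply: sC.
  exists (fun i => dotv (u i) e *: e + s i *: orth i); last by rewrite pointE.
  move=> i; case: (sk i) => // ->; [left|right].
    by rewrite scale1r /orth addrC subrK.
  rewrite scaleN1r /orth opprB addrA addrC /reflect_about; congr (_ + _).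
  by rewrite -scalerDl -mulr2n mulr_natl.
pose K := Ordinal kN.
pose sa (a : R) i := if i == K then a else s i.
have saC a : -1 <= a <= 1 -> a = 1 \/ a = -1 -> cone C (T *: e + zono orth (sa a)).
  move=> a1 aa; apply: IH => [|i|i]; first exact: ltnW.
    by rewrite /sa; case: ifP.
  rewrite leq_eqVlt => /orP[/eqP ki|ki].
    by rewrite /sa ifT//; apply/eqP/val_inj.
  by rewrite /sa; case: ifP => // _; exact: sk.
have /andP[sK1 sK2] := s1 K.
have -> : T *: e + zono orth s = ((1 + s K) / 2) *: (T *: e + zono orth (sa 1)) +
    ((1 - s K) / 2) *: (T *: e + zono orth (sa (-1))).
  rewrite !scalerDr addrACA !scalerA -scalerDl; congr (_ + _).
    by congr (_ *: _); field.
  rewrite /zono !scaler_sumr -big_split/=; apply: eq_bigr => i _.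
  rewrite !scalerA -scalerDl; congr (_ *: _); rewrite /sa.
  by case: eqP => [->|_]; field.
have N11 : -1 <= (-1 : R) <= 1 by apply/andP; split; lra.
have N1 : -1 <= (1 : R) <= 1 by apply/andP; split; lra.
apply: coneD => //; apply: coneZ.
- by rewrite divr_ge0//; lra.
- by apply: saC => //; left.
- by rewrite divr_ge0//; lra.
- by apply: saC => //; right.
Qed.

(** Vertices satisfy the inequalities termwise. Conversely, a point of the support body is scaled to
    height [T], so that subtracting [T *: e] leaves a point to which [zono_support] applies. *)
Lemma discrete_centroid_bodyE : discrete_centroid_body e u = support_body e h T.
Proof.
have ee : dotv e e = 1 by exact/sphereP.
apply/seteqP; split => [|x Gx].
  apply: sconv_sub; first exact: support_body_sconvex.
  move=> _ [v vu <-]; rewrite /centroid_points.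
  set m := \sum_(i < N) v i.
  have me : dotv m e = T.
    rewrite /m dotv_suml; apply: eq_bigr => i _.
    by case: (vu i) => ->//; rewrite dotv_reflect_center.
  have m0 : m != 0 by apply: contraTneq T0 => m0; rewrite -me m0 dotv0l ltxx.
  have nm : 0 < (enorm m)^-1 by rewrite invr_gt0 enorm_gt0.
  split; first exact: sphere_normalize.
  split; first by rewrite /normalize dotvZl me mulr_ge0// ltW.
  move=> w we; rewrite /normalize !dotvZl mulrCA -mulrA ler_pM2l// me ler_pM2l//.
  rewrite /m dotv_suml; apply: ler_sum => i _.
  case: (vu i) => ->; first exact: ler_norm.
  by rewrite dotv_reflect_orth// -normrN ler_norm.
move=> C [cC sC].
have [x1 [_ xh]] := Gx; have [_ xe] := support_body_pos T0 Gx; rewrite dotvC in xe.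
apply: (cone_sphere cC.1 x1).
pose z := (T / dotv x e) *: x.
have ze : dotv z e = T by rewrite /z dotvZl mulfVK// gt_eqF.
have orthe v : dotv (v - dotv v e *: e) e = 0 by rewrite dotvBl dotvZl ee mulr1 subrr.
have [s s1 zs] : exists2 s : 'I_N -> R, (forall i, -1 <= s i <= 1) &
    z - T *: e = zono orth s.
  apply: (@zono_support _ _ _ orth [set v | dotv v e = 0]).
  - by move=> v w a /= ve we; rewrite dotvDl dotvZl ve we mulr0 addr0.
  - by rewrite /= -{1}ze orthe.
  - by move=> i; exact: orthe.
  - move=> v /= ve; rewrite dotvBl dotvZl (dotvC e) ve mulr0 subr0.
    rewrite (eq_bigr (fun i => `|dotv (u i) v|)); last first.
      by move=> i _; rewrite /orth dotvBl dotvZl (dotvC e) ve mulr0 subr0.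
    by rewrite /z dotvZl mulrAC ler_pdivrMr// [leRHS]mulrC xh.
have : cone C z.
  by rewrite -(subrK (T *: e) z) zs addrC; exact: cone_vertices.
move=> /(@coneZ _ _ _ (dotv x e / T)); rewrite divr_ge0 ?ltW// => /(_ erefl).
by rewrite /z scalerA mulrA mulfVK ?divff ?scale1r// gt_eqF.
Qed.

End discrete_body.

(** * Strong law of large numbers *)

Lemma sqr_succ k : (k.+2 ^ 2 = k.+1 ^ 2 + 2 * k.+1 + 1)%N.
Proof. by rewrite -[k.+2]addn1 sqrnD exp1n muln1 addnAC. Qed.

Lemma square_interval (N : nat) : (0 < N)%N ->
  exists k, (k.+1 ^ 2 <= N < k.+2 ^ 2)%N.
Proof.
elim: N => // -[_ _|N IH _]; first by exists 0%N.
have [//|k /andP[k1 k2]] := IH.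
have [kN|kN] := ltnP N.+2 (k.+2 ^ 2); first by exists k; apply/andP; split; lia.
by exists k.+1; apply/andP; split; [lia|rewrite !expnS expn0 !muln1 in k2 *; lia].
Qed.

Section averages.
Context {R : realType}.

Lemma ler_norm_sub2 (a b c t q : R) : 0 <= a -> a <= c -> 0 <= b -> b <= c ->
  c <= 2 * t -> 0 <= t -> t <= q -> `|a - b| <= 4 * q.
Proof. by move=> *; rewrite ler_norml; apply/andP; split; lra. Qed.

(** Increments are between 0 and 1 and at most 2 (k + 1) indices lie after one square and before the
    next, so the averages there vary by O(1 / (k + 1)). *)
Lemma cvg_average_squares (S : nat -> R) (p : R) :
  (forall m n, (m <= n)%N -> 0 <= S n - S m <= (n - m)%:R) -> S 0%N = 0 ->
  (fun k => S (k.+1 ^ 2)%N / (k.+1 ^ 2)%:R) @ \oo --> p ->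
  (fun N => S N / N%:R) @ \oo --> p.
Proof.
move=> Sincr S0 /cvgrPdist_lt Scvg; apply/cvgrPdist_lt => eps eps0.
have e2 : 0 < eps / 2 by rewrite divr_gt0.
(* The comparison [bound] costs 4 / (k + 1), which has to stay below eps / 2. *)
have e8 : 0 < eps / 8 by rewrite divr_gt0.
have [K _ HK] := Scvg _ e2.
have [L _ HL] := near_infty_natSinv_lt (PosNum e8).
near=> N.
have N0 : (0 < N)%N by near: N; exact: nbhs_infty_gt.
have [k /andP[k1 k2]] := square_interval N0.
have kK : (maxn K L <= k)%N.
  have : ((maxn K L).+2 ^ 2 <= N)%N by near: N; exact: nbhs_infty_ge.
  by move=> H; have := leq_ltn_trans H k2; rewrite ltn_exp2r// !ltnS => /ltnW.
have {}HK : `|p - S (k.+1 ^ 2)%N / (k.+1 ^ 2)%:R| < eps / 2.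
  by apply: HK => /=; rewrite (leq_trans _ kK)// leq_maxl.
have {}HL : k.+1%:R^-1 < eps / 8.
  by apply: HL => /=; rewrite (leq_trans _ kK)// leq_maxr.
set M := (k.+1 ^ 2)%N in k1 HK *.
have M0 : (0 < M)%N by rewrite expn_gt0.
have MR : 0 < M%:R :> R by rewrite ltr0n.
have NR : 0 < N%:R :> R by rewrite ltr0n.
have /andP[d0 d1] := Sincr _ _ k1.
have /andP[s0 s1] := Sincr _ _ (leq0n M); rewrite S0 subr0 subn0 in s0 s1.
have NM : (N - M <= 2 * k.+1)%N 
  by move: k2; rewrite sqr_succ addn1 ltnS leq_subLR.
have NMR : N%:R - M%:R <= 2 * k.+1%:R :> R.
  by rewrite -natrB// -natrM ler_nat.
have MN : M%:R <= N%:R :> R by rewrite ler_nat.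
rewrite natrB// in d1.
have bound : `|S M / M%:R - S N / N%:R| <= 4 * k.+1%:R^-1.
  have -> : S M / M%:R - S N / N%:R =
     (S M / M%:R * (N%:R - M%:R) - (S N - S M)) / N%:R.
    by field; rewrite !gt_eqF.
  rewrite normrM normfV (gtr0_norm NR) ler_pdivrMr//.
  have s2 : 0 <= S M / M%:R by rewrite divr_ge0// ltW.
  have s3 : S M / M%:R <= 1 by rewrite ler_pdivrMr// mul1r.
  have s4 : 0 <= S M / M%:R * (N%:R - M%:R) by rewrite mulr_ge0// subr_ge0.
  have s5 : S M / M%:R * (N%:R - M%:R) <= N%:R - M%:R.
    by rewrite ler_piMl// subr_ge0.
  have s6 : k.+1%:R <= k.+1%:R^-1 * N%:R :> R.
    by rewrite mulrC ler_pdivlMr ?ltr0n// -natrM ler_nat (leq_trans _ k1).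
  have kk : 0 <= k.+1%:R :> R by [].
  by rewrite -[leRHS]mulrA; exact: (ler_norm_sub2 s4 s5 d0 d1 NMR kk s6).
rewrite -(subrK (S M / M%:R) p) -addrA (le_lt_trans (ler_normD _ _))//.
rewrite [eps]splitr ltrD//; apply: le_lt_trans bound _.
by rewrite (_ : eps / 2 = 4 * (eps / 8)) ?ltr_pM2l//; field.
Unshelve. all: by end_near. Qed.

(** Telescoping: 1 / a^2 <= 2 (1 / a - 1 / (a + 1)) for a >= 1. *)
Lemma sum_inv_squares_le n : \sum_(0 <= k < n) (k.+1%:R ^+ 2)^-1 <= 2 * (1 - n.+1%:R^-1) :> R.
Proof.
elim: n => [|n IH]; first by rewrite big_geq// invr1 subrr mulr0.
rewrite big_nat_recr//= (le_trans (lerD IH (lexx _)))//.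
have n1 : 1 <= n.+1%:R :> R by rewrite ler1n.
rewrite -[n.+2]addn1 natrD; move: (n.+1%:R : R) n1 => a a_ge1.
have a0 : 0 < a by rewrite (lt_le_trans ltr01).
have a1 : 0 < a + 1 by rewrite addr_gt0.
rewrite -subr_ge0.
have -> : 2 * (1 - (a + 1)^-1) - (2 * (1 - a^-1) + (a ^+ 2)^-1) =
    (a - 1) / (a ^+ 2 * (a + 1)) by field; rewrite !gt_eqF.
by rewrite divr_ge0 ?subr_ge0// mulr_ge0 ?sqr_ge0// ltW.
Qed.

End averages.

Section strong_law.
Context d (T : measurableType d) (R : realType) (P : probability T R).
Variables (A : nat -> set T) (p : R).
Hypothesis mA : forall i, measurable (A i).
Hypothesis PA : forall i, P (A i) = p%:E.
Hypothesis PAA : forall i j, i != j -> P (A i `&` A j) = (p ^+ 2)%:E.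

Let S N (w : T) : R := \sum_(i < N) \1_(A i) w.

Lemma integrable_bounded (f : T -> R) C : measurable_fun setT f ->
  (forall x, `|f x| <= C) -> P.-integrable setT (EFin \o f).
Proof.
move=> mf fC; apply: measurable_bounded_integrable => //.
  exact: (le_lt_trans (probability_le1 P measurableT) (ltry 1)).
exists C; split; first exact: num_real.
by move=> M CM x _ /=; rewrite (le_trans (fC _))// ltW.
Qed.

Let p01 : 0 <= p <= 1.
Proof.
by apply/andP; split; rewrite -lee_fin -(PA 0%N) ?measure_ge0// probability_le1.
Qed.

Let X i (w : T) : R := \1_(A i) w - p.

Let mX i : measurable_fun setT (X i).
Proof. by apply: measurable_funB; [exact: measurable_indic|exact: measurable_cst]. Qed.

Let X1 i w : `|X i w| <= 1.
Proof.
have /andP[? ?] := p01.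
by rewrite /X indicE ler_norml; case: (_ \in _) => /=; apply/andP; split; lra.
Qed.

Let iXX i j : P.-integrable setT (EFin \o (fun w => X i w * X j w)).
Proof.
apply: (@integrable_bounded _ 1); first exact: measurable_funM.
by move=> w; rewrite normrM mulr_ile1.
Qed.

Let covXX i j : Rintegral P setT (fun w => X i w * X j w) =
  if i == j then p - p ^+ 2 else 0.
Proof.
have iI (B : set T) : measurable B -> P.-integrable setT (EFin \o (\1_B : T -> R)).
  move=> mB; apply: (@integrable_bounded _ 1); first exact: measurable_indic.
  by move=> w; rewrite indicE ger0_norm; case: (_ \in _).
have IB (B : set T) : measurable B -> Rintegral P setT (\1_B : T -> R) = fine (P B).
  by move=> mB; rewrite /Rintegral integral_indic// setIT.
have mAA : measurable (A i `&` A j) by exact: measurableI.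
have E w : X i w * X j w = \1_(A i `&` A j) w - (p * (\1_(A i) w + \1_(A j) w) - p ^+ 2).
  by rewrite /X indicI /=; ring.
under eq_Rintegral do rewrite E.
have iAA : P.-integrable setT (EFin \o (fun w => \1_(A i) w + \1_(A j) w : R)).
  exact: (integrableD measurableT (iI _ (mA i)) (iI _ (mA j))).
have ipAA : P.-integrable setT (EFin \o (fun w => p * (\1_(A i) w + \1_(A j) w) : R)).
  exact: (integrableZl measurableT p iAA).
have ip : P.-integrable setT (EFin \o (fun _ : T => p ^+ 2)).
  by apply: (@integrable_bounded _ `|p ^+ 2|); [exact: measurable_cst|].
rewrite RintegralB//; [|exact: iI|exact: (integrableB measurableT ipAA ip)].
rewrite RintegralB// RintegralZl// RintegralD//; [|exact: iI|exact: iI].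
have -> : Rintegral P setT (fun=> p ^+ 2) = p ^+ 2.
  rewrite Rintegral_cst// [X in _ * X](_ : _ = 1) ?mulr1//.
  exact: (congr1 fine (probability_setT P)).
rewrite (IB _ mAA) (IB _ (mA i)) (IB _ (mA j)) !PA.
by case: eqVneq => [->|ij]; rewrite ?setIid ?PA ?PAA//=; ring.
Qed.

(** Pairwise independence kills the off-diagonal covariances; the N diagonal ones are p - p^2 <=
    1. *)
Lemma second_moment_average N : (0 < N)%N ->
  Rintegral P setT (fun w => (S N w / N%:R - p) ^+ 2) <= N%:R^-1.
Proof.
move=> N0; have NR : 0 < N%:R :> R by rewrite ltr0n.
have E w : (S N w / N%:R - p) ^+ 2 =
    N%:R ^- 2 * \sum_(i < N) \sum_(j < N) X i w * X j w.
  have -> : \sum_(i < N) \sum_(j < N) X i w * X j w = (\sum_(i < N) X i w) ^+ 2.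
    by rewrite expr2 mulr_suml; apply: eq_bigr => i _; rewrite mulr_sumr.
  have -> : \sum_(i < N) X i w = S N w - p * N%:R.
    by rewrite /X sumrB sumr_const card_ord mulr_natr.
  by field; rewrite gt_eqF.
under eq_Rintegral do rewrite E.
have iS i : P.-integrable setT (EFin \o (fun w => \sum_(j < N) X i w * X j w)).
  by apply: integrable_Rsum.
rewrite RintegralZl//; last exact: integrable_Rsum.
rewrite (@Rintegral_sum _ _ _ _ _ _ (fun (i : 'I_N) w => \sum_(j < N) X i w * X j w))//.
rewrite (eq_bigr (fun _ => p - p ^+ 2)); last first.
  move=> i _; rewrite (@Rintegral_sum _ _ _ _ _ _ (fun (j : 'I_N) w => X i w * X j w))//.
  rewrite (bigD1 i)//= covXX eqxx big1 ?addr0// => j ji.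
  by rewrite covXX; case: eqP => // /val_inj E'; rewrite E' eqxx in ji.
rewrite sumr_const card_ord -[(p - p ^+ 2) *+ N]mulr_natr.
have /andP[? ?] := p01.
rewrite [leLHS](_ : _ = (p - p ^+ 2) / N%:R); last by field; rewrite gt_eqF.
by rewrite ler_pdivrMr// mulVf ?gt_eqF//; nra.
Qed.

(** Along the squares the second moments are at most 1 / (k + 1)^2, hence summable. So the series of
    squared deviations has finite integral, converges almost everywhere, and its terms tend to 0;
    [cvg_average_squares] fills the gaps. *)
Lemma strong_law_events :
  {ae P, forall w, (fun N => S N w / N%:R) @ \oo --> p}.
Proof.
pose Y k w := (S (k.+1 ^ 2)%N w / (k.+1 ^ 2)%:R - p) ^+ 2.
have Y0 k w : 0 <= Y k w by exact: sqr_ge0.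
have mS N : measurable_fun setT (S N).
  by apply: measurable_sum => i; exact: measurable_indic.
have mY k : measurable_fun setT (Y k).
  apply: measurable_funX; apply: measurable_funB; last exact: measurable_cst.
  by apply: measurable_funM; [exact: mS|exact: measurable_cst].
have S01 N w : 0 <= S N w / N%:R <= 1.
  have S1 : S N w <= N%:R.
    rewrite /S -[N in N%:R]card_ord -sum1_card natr_sum; apply: ler_sum => i _.
    by rewrite indicE; case: (_ \in _).
  have S0 : 0 <= S N w by apply: sumr_ge0.
  rewrite divr_ge0//=; have [->|N0] := posnP N; first by rewrite invr0 mulr0.
  by rewrite ler_pdivrMr ?ltr0n// mul1r.
have iY k : P.-integrable setT (EFin \o Y k).
  apply: (@integrable_bounded _ 1) => // w.
  rewrite ger0_norm// /Y; move: (S01 (k.+1 ^ 2)%N w) p01.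
  move: (S _ w / _) => x /andP[? ?] /andP[? ?].
  rewrite -real_normK ?num_real// exprn_ile1//.
  by rewrite ler_norml; apply/andP; split; lra.
have EY : (\int[P]_w \sum_(k <oo) (Y k w)%:E < +oo)%E.
  rewrite integral_nneseries//; last 2 first.
  - by move=> k; exact/measurable_EFinP.
  - by move=> k w _; rewrite lee_fin.
  apply: (@le_lt_trans _ _ 2%:E); last exact: ltry.
  apply: lime_le.
    by apply: is_cvg_nneseries => k _ _; apply: integral_ge0 => w _; rewrite lee_fin.
  apply: nearW => n.
  apply: (@le_trans _ _ (\sum_(0 <= k < n) ((k.+1%:R ^+ 2)^-1 : R)%:E)%E).
    apply: lee_sum => k _.
    have -> : (\int[P]_w (Y k w)%:E = (Rintegral P setT (Y k))%:E)%E.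
      by rewrite /Rintegral fineK//; exact: (integrable_fin_num measurableT (iY k)).
    by rewrite lee_fin -natrX; apply: second_moment_average; rewrite expn_gt0.
  rewrite sumEFin lee_fin (le_trans (sum_inv_squares_le _))//.
  by rewrite ler_piMr// gerBl invr_ge0.
have iYs : P.-integrable setT (fun w => \sum_(k <oo) (Y k w)%:E)%E.
  apply/integrableP; split.
    by apply: ge0_emeasurable_sum => k *; [rewrite lee_fin|exact/measurable_EFinP].
  rewrite (eq_integral (fun w => (\sum_(k <oo) (Y k w)%:E)%E)); first exact: EY.
  by move=> w _; rewrite gee0_abs// nneseries_ge0// => k _ _; rewrite lee_fin.
have := integrable_ae measurableT iYs; apply: filterS => w /(_ I) Yfin.
have Ycvg : (fun k => Y k w) @ \oo --> 0.
  apply: cvg_series_cvg_0; apply: nnseries_is_cvg => //.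
  by rewrite -ge0_fin_numE// nneseries_ge0// => k _ _; rewrite lee_fin.
apply: cvg_average_squares.
- move=> m n mn; rewrite /S -!(big_mkord xpredT (fun i => \1_(A i) w : R)).
  rewrite (@big_cat_nat _ _ _ m 0 n)//= addrAC subrr add0r; apply/andP; split.
    by apply: sumr_ge0.
  rewrite -[(n - m)%N]muln1 -sum_nat_const_nat natr_sum; apply: ler_sum => i _.
  by rewrite indicE; case: (_ \in _).
- by rewrite /S big_ord0.
- apply/cvgrPdist_lt => eps eps0.
  have eps2 : 0 < eps ^+ 2 by rewrite exprn_gt0.
  move/cvgrPdist_lt : Ycvg => /(_ _ eps2); apply: filterS => k.
  rewrite sub0r normrN ger0_norm// /Y -real_normK ?num_real// distrC.
  by rewrite ltr_pXn2r// nnegrE ltW.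
Qed.

End strong_law.

(** * Cutting the sphere into small cells *)

Section sphere_partition.
Context {R : realType} (n : nat).
Local Notation V := 'rV[R]_n.+1.

Lemma sphere_partition (r : R) : 0 < r ->
  exists (I : finType) (B : I -> set V), [/\ forall i, measurable (B i),
    forall x, sphere n x -> \sum_i \1_(B i) x = 1 :> R &
    forall i x y, B i x -> B i y -> enorm (x - y) < r].
Proof.
(* The divisor is that of [enorm_lt_coord] in dimension n + 1. *)
move=> r0; have r1 : 0 < r / n.+2%:R by rewrite divr_gt0.
have [k /= kr] := filter_ex (near_infty_natSinv_lt (PosNum r1)).
have k0 : 0 < k.+1%:R :> R by rewrite ltr0n.
pose g (x : V) i := k.+1%:R * (x 0 i + 1).
(* On the sphere [g] takes values in [0, 2 (k + 1)], right end included, whence one extra index. *)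
pose B (c : {ffun 'I_n.+1 -> 'I_(k.+1).*2.+1}) : set V :=
  [set x | forall i, (c i)%:R <= g x i < (c i).+1%:R].
exists {ffun 'I_n.+1 -> 'I_(k.+1).*2.+1}, B; split.
- move=> c; rewrite (_ : B c = \bigcap_(i in [set: 'I_n.+1])
    (g ^~ i @^-1` `[(c i)%:R, (c i).+1%:R[%classic)).
    apply: fin_bigcap_measurable => // i _; apply: measurable_preimage => //.
    apply: measurable_funM; first exact: measurable_cst.
    by apply: measurable_funD; [exact: measurable_coord|exact: measurable_cst].
  by apply/seteqP; split => x /= H i; [move=> _; rewrite /= in_itv/=|
    have := H i I; rewrite /= in_itv/=].
- move=> x x1.
  have x_itv i : 0 <= g x i /\ g x i < (k.+1).*2.+1%:R.
    have := le_coord_enorm x i; rewrite x1 ler_norml => /andP[xi1 xi2].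
    split; first by rewrite mulr_ge0 ?(ltW k0)//; lra.
    apply: (@le_lt_trans _ _ (k.+1.*2)%:R); last by rewrite ltr_nat.
    by rewrite -muln2 natrM ler_pM2l//; lra.
  have tr i : (Num.truncn (g x i) < (k.+1).*2.+1)%N.
    have [g0 g1] := x_itv i.
    by rewrite -(ltr_nat R) (le_lt_trans _ g1)//; have /andP[] := truncn_itv g0.
  pose c := [ffun i => Ordinal (tr i)].
  rewrite (bigD1 c)//= big1 ?addr0.
    rewrite indicE mem_set// => i; rewrite ffunE /=.
    by apply: truncn_itv; have [] := x_itv i.
  move=> c' cc'; rewrite indicE memNset// => Bc'; case/eqP: cc'.
  by apply/ffunP => i; apply/val_inj; rewrite ffunE /= (truncn_def (Bc' i)).
- move=> c x y Bx By; apply: enorm_lt_coord => // i; rewrite !mxE.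
  apply: lt_trans kr; rewrite -[ltRHS]mul1r ltr_pdivlMr//.
  rewrite -[X in _ * X](gtr0_norm k0) -normrM.
  rewrite (_ : _ * _ = g x i - g y i); last by rewrite /g; ring.
  have := Bx i; have := By i; rewrite -!natr1.
  move: (c i)%:R (g x i) (g y i) => a s t /andP[? ?] /andP[? ?].
  by rewrite ltr_norml; apply/andP; split; lra.
Qed.

End sphere_partition.

(** * Law of large numbers uniform over Lipschitz functions *)

Section uniform_law.
Context {R : realType} (n : nat).
Local Notation V := 'rV[R]_n.+1.
Local Notation sigma := (@spherical_measure R n).
Variables (K : set V).
Hypotheses (mK : measurable K) (Ksph : K `<=` sphere n).
Hypothesis K0 : (0 < sigma K)%E.
Context (d : measure_display) (Omega : measurableType d) (P : probability Omega R).
Variable U : nat -> {RV P >-> V}.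
Hypothesis U_unit : forall i w, sphere n (U i w).
Hypothesis U_indep : mutually_independent U.
Hypothesis U_unif : forall i, uniformly_distributed_in K (U i).

Let s : R := fine (sigma K).
Let s0 : 0 < s.
Proof.
by rewrite -lte_fin fineK// ge0_fin_numE// spherical_measure_lty.
Qed.

Definition sample_mean (f : V -> R) (N : nat) (w : Omega) : R :=
  (\sum_(j < N) f (U j w)) / N%:R.

Definition body_mean (f : V -> R) : R := Rintegral sigma K f / fine (sigma K).

Lemma prob_cell (B : set V) i : measurable B ->
  P (U i @^-1` B) = (fine (sigma (B `&` K)) / fine (sigma K))%:E.
Proof.
move=> mB; have := U_unif i mB; rewrite /distribution/= /pushforward => ->.
have fK A : measurable A -> sigma A = (fine (sigma A))%:E.
  by move=> mA; rewrite fineK// ge0_fin_numE// spherical_measure_lty.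
have mBK : measurable (B `&` K) by exact: measurableI.
rewrite [in LHS](fK _ mBK) [in LHS](fK _ mK).
by rewrite inver (gt_eqF s0) -EFinM.
Qed.

Lemma sample_mean_indic (B : set V) : measurable B ->
  {ae P, forall w, sample_mean \1_B ^~ w @ \oo --> fine (sigma (B `&` K)) / fine (sigma K)}.
Proof.
move=> mB.
have := @strong_law_events _ _ _ P (fun i => U i @^-1` B) (fine (sigma (B `&` K)) / fine (sigma K)).
apply.
- by move=> i; exact: (measurable_preimage (measurable_funPT (U i)) mB).
- by move=> i; exact: prob_cell.
- move=> i j ij; have := @U_indep [fset i; j]%fset (fun=> B) (fun=> mB).
  rewrite bigcap_fsetU1 bigcap_fset big_seq_fset1 big_fsetU1 ?inE//= big_seq_fset1 => ->.
  by rewrite !prob_cell// expr2 EFinM.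
Qed.

(** The threshold for N depends on the cells only, so one null set and one threshold serve all f;
    the countably many accuracies 1 / (k + 1) give every eps. *)
Lemma uniform_law : {ae P, forall w (eps : R), 0 < eps ->
  \forall N \near \oo, forall f : V -> R, measurable_fun setT f ->
    (forall x, sphere n x -> `|f x| <= 1) ->
    (forall x y, sphere n x -> sphere n y -> `|f x - f y| <= enorm (x - y)) ->
    `|sample_mean f N w - body_mean f| <= eps}.
Proof.
(* One r each for passing to a step function in the sample mean, for the cell frequencies, and for
   passing back in the mean over [K]. *)
suff H (r : R) : 0 < r -> {ae P, forall w,
  \forall N \near \oo, forall f : V -> R, measurable_fun setT f ->
    (forall x, sphere n x -> `|f x| <= 1) ->
    (forall x y, sphere n x -> sphere n y -> `|f x - f y| <= enorm (x - y)) ->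
    `|sample_mean f N w - body_mean f| <= 3 * r}.
  have H' (k : nat) : 0 < (k.+1%:R^-1 : R) by rewrite invr_gt0.
  have := ae_foralln (fun k => H _ (H' k)); apply: filterS => w Hw eps eps0.
  have eps3 : 0 < eps / 3 by rewrite divr_gt0.
  have [k /= kr] := filter_ex (near_infty_natSinv_lt (PosNum eps3)).
  apply: filterS (Hw k) => N HN f mf f1 fl.
  rewrite (le_trans (HN f mf f1 fl))// mulrC -ler_pdivlMr//.
  exact: ltW.
move=> r0; have [I [B [mB B1 Br]]] := sphere_partition n r0.
pose p i := fine (sigma (B i `&` K)) / s.
have : {ae P, forall w i, sample_mean \1_(B i) ^~ w @ \oo --> p i}.
  by apply: filter_forall => i; exact: sample_mean_indic.
apply: filterS => w Hw.
have I0 : 0 < #|I|.+1%:R :> R by rewrite ltr0n.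
have rI : 0 < r / #|I|.+1%:R by rewrite divr_gt0.
have : \forall N \near \oo, forall i, `|p i - sample_mean \1_(B i) N w| < r / #|I|.+1%:R.
  by apply: filter_forall => i; move/cvgrPdist_lt : (Hw i); exact.
apply: filterS2 (nbhs_infty_gt 0) => N N0 HN f mf f1 fl.
have NR : 0 < N%:R :> R by rewrite ltr0n.
(* A value of f on the cell; cells missing the sphere get the dummy value 0. *)
have /choice[a Ba] : forall i, exists a : R, `|a| <= 1 /\
    forall x, sphere n x -> B i x -> `|f x - a| <= r.
  move=> i; have [[y [y1 By]]|nB] := pselect (exists y, sphere n y /\ B i y).
    exists (f y); split; first exact: f1.
    by move=> x x1 Bx; rewrite (le_trans (fl _ _ x1 y1))// ltW// (Br i).
  by exists 0; split => [|x x1 Bx]; [rewrite normr0|case: nB; exists x].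
pose g (x : V) : R := \sum_i a i * \1_(B i) x.
have fg x : sphere n x -> `|f x - g x| <= r.
  move=> x1; have -> : f x - g x = \sum_i (f x - a i) * \1_(B i) x.
    rewrite -[in LHS](mulr1 (f x)) -(B1 x x1) mulr_sumr -sumrB.
    by apply: eq_bigr => i _; rewrite mulrBl.
  rewrite (le_trans (ler_norm_sum _ _ _))//.
  rewrite -[leRHS]mulr1 -(B1 x x1) mulr_sumr; apply: ler_sum => i _.
  rewrite normrM indicE [X in _ * X]ger0_norm//.
  have [xB|_] := boolP (x \in B i); last by rewrite !mulr0.
  by rewrite !mulr1; have [_] := Ba i; apply => //; exact: set_mem.
have mg : measurable_fun setT g.
  apply: measurable_sum => i; apply: measurable_funM.
    exact: measurable_cst.
  exact: measurable_indic.
have E1 : `|sample_mean f N w - sample_mean g N w| <= r.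
  rewrite /sample_mean -mulrBl normrM normfV (gtr0_norm NR) ler_pdivrMr// -sumrB.
  rewrite (le_trans (ler_norm_sum _ _ _))// mulr_natr -[N in leRHS]card_ord -sumr_const.
  by apply: ler_sum => j _; exact: fg.
have E2 : `|sample_mean g N w - \sum_i a i * p i| <= r.
  have -> : sample_mean g N w = \sum_i a i * sample_mean \1_(B i) N w.
    rewrite /sample_mean /g exchange_big/= mulr_suml; apply: eq_bigr => i _.
    by rewrite -mulr_sumr mulrA.
  rewrite -sumrB (le_trans (ler_norm_sum _ _ _))//.
  apply: (@le_trans _ _ (\sum_(i : I) r / #|I|.+1%:R)).
    apply: ler_sum => i _; rewrite -mulrBr normrM.
    have [a1 _] := Ba i; rewrite (le_trans (ler_piMl _ a1))//.
    by rewrite distrC ltW.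
  rewrite sumr_const -[leLHS]mulr_natr mulrAC ler_pdivrMr// ler_pM2l// ler_nat.
  by rewrite (leq_trans (max_card _)).
have g1 x : sphere n x -> `|g x| <= 1 + r.
  move=> x1; rewrite -(subrK (f x) (g x)) addrC (le_trans (ler_normD _ _))//.
  by rewrite lerD ?f1// distrC fg.
have E3 : body_mean g = \sum_i a i * p i.
  have ib i : sigma.-integrable K (EFin \o (\1_(B i) : V -> R)).
    apply: (integrable_sphere (C := 1)) => //.
    by move=> x _; rewrite indicE ger0_norm//; case: (_ \in _).
  have iab i : sigma.-integrable K (EFin \o (fun x => a i * \1_(B i) x)).
    exact: (integrableZl mK (a i) (ib i)).
  rewrite /body_mean /g (@Rintegral_sum _ _ _ _ _ _ (fun i x => a i * \1_(B i) x))//.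
  rewrite mulr_suml; apply: eq_bigr => i _.
  by rewrite RintegralZl// -mulrA /Rintegral integral_indic.
have E4 : `|body_mean f - body_mean g| <= r.
  rewrite /body_mean -mulrBl normrM normfV (gtr0_norm s0) ler_pdivrMr//.
  have iff : sigma.-integrable K (EFin \o f) by exact: integrable_sphere mf f1.
  have ig : sigma.-integrable K (EFin \o g) by exact: integrable_sphere mg g1.
  have ifg : sigma.-integrable K (EFin \o (fun x => f x - g x)).
    exact: (integrableB mK iff ig).
  rewrite -RintegralB// (le_trans (le_normr_Rintegral mK ifg))//.
  rewrite -(Rintegral_cst sigma mK); apply: le_Rintegral => //.
  - apply: (integrable_sphere (C := r)) => //.
      by apply: measurableT_comp => //; exact: measurable_funB.
    by move=> x x1; rewrite normr_id fg.
  - exact: (integrable_sphere (C := `|r|)).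
  - by move=> x /Ksph/fg.
rewrite E3 in E4; move: E1 E2 E4.
move: (sample_mean f N w) (sample_mean g N w) (body_mean f) (\sum_i a i * p i) => x y z t.
rewrite !ler_norml => /andP[? ?] /andP[? ?] /andP[? ?].
by apply/andP; split; lra.
Qed.

End uniform_law.

(** * Hausdorff convergence *)

Section hausdorff.
Context {R : realType} (n : nat).
Local Notation V := 'rV[R]_n.+1.
Implicit Types (A B G : set V) (u v x y : V).

Lemma acos_le (t a : R) : 0 <= t <= pi -> cos t <= a -> a <= 1 -> acos a <= t.
Proof.
move=> /andP[t0 tpi] ta a1; rewrite leNgt; apply/negP => tacos.
have a11 : -1 <= a <= 1 by rewrite a1 (le_trans (cos_geN1 t)).
have : cos (acos a) < cos t.
  by rewrite ltr_cos ?in_itv/= ?t0 ?tpi ?acos_ge0 ?acos_lepi.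
by rewrite acosK ?in_itv//= ltNge ta.
Qed.

Lemma shausdorff_ge0 A B : (0 <= shausdorff A B)%E.
Proof. by apply: le_ereal_inf_tmp => _ [r [/andP[r0 _] _] <-]; rewrite lee_fin. Qed.

Lemma shausdorff_le A B (t : R) : 0 <= t <= pi ->
  (forall x, A x -> sphere n x /\ exists2 y, B y & cos t <= dotv x y) ->
  (forall y, B y -> sphere n y /\ exists2 x, A x & cos t <= dotv y x) ->
  (shausdorff A B <= t%:E)%E.
Proof.
move=> t0pi AB BA; apply: ereal_inf_lbound; exists t => //; split => //.
suff thick (C D : set V) : (forall x, D x -> sphere n x) ->
    (forall x, C x -> sphere n x /\ exists2 y, D y & cos t <= dotv x y) ->
    C `<=` sthickening D t.
  by split; apply: thick => // x; [move=> /BA[]|move=> /AB[]].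
move=> D1 CD x /CD[x1 [y Dy xy]]; split => //.
apply: le_trans (_ : (sdist x y)%:E <= _)%E.
  by apply: ereal_inf_lbound; exists y.
rewrite lee_fin; apply: acos_le => //.
by rewrite (le_trans (ler_norm _))// (le_trans (ler_dotv _ _))// x1 (D1 _ Dy) mulr1.
Qed.

Variable e : V.
Hypothesis e1 : sphere n e.

(* The gnomonic dilation [t e + w |-> t e + l w] maps one body into the other
   and moves points by at most [acos l]. *)
Lemma support_body_near (W W' : V -> R) (c c' l : R) x : 0 < c -> 0 < c' -> 0 < l <= 1 ->
  (forall u, dotv u e = 0 -> l * W' u * c <= W u * c') ->
  support_body e W' c' x ->
  exists2 y, support_body e W c y & l <= dotv x y.
Proof.
move=> c0 c'0 /andP[l0 l1] WW Gx.
have [_ xe] := support_body_pos c'0 Gx; have [x1 [_ xW]] := Gx.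
rewrite dotvC in xe.
have ee : dotv e e = 1 by exact/sphereP.
have [t [w [tE we xE]]] : exists t w, [/\ dotv x e = t, dotv w e = 0 & x = t *: e + w].
  exists (dotv x e), (x - dotv x e *: e); split => //; last by rewrite addrC subrK.
  by rewrite dotvBl dotvZl ee mulr1 subrr.
have ew : dotv e w = 0 by rewrite dotvC.
rewrite tE in xe xW.
pose z := t *: e + l *: w.
have ze : dotv z e = t by rewrite /z !dotvE ee we mulr1 mulr0 addr0.
have z0 : z != 0.
  by apply/eqP => z0; move: xe; rewrite -ze z0 dotv0l ltxx.
have nz : 0 < enorm z by rewrite enorm_gt0.
have ww0 := dotv_ge0 w.
have tw : t ^+ 2 + dotv w w = 1.
  have := (sphereP x).1 x1; rewrite {1 2}xE !dotvE ee we ew; lra.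
have zz : dotv z z = t ^+ 2 + l ^+ 2 * dotv w w.
  by rewrite /z !dotvE ee we ew; ring.
have xz : dotv x z = t ^+ 2 + l * dotv w w.
  by rewrite /z {1}xE !dotvE ee we ew; ring.
(* z is x with its tangential part shrunk, so |z| <= |x| = 1, and below x . z >= l >= l |z|. *)
have nz1 : enorm z <= 1.
  rewrite -(@ler_pXn2r _ 2%N) ?nnegrE ?enorm_ge0// sqr_enorm zz expr1n -tw lerD2l.
  by rewrite ler_piMl// exprn_ile1// ltW.
exists (normalize z); last first.
  rewrite /normalize dotvZr mulrC ler_pdivlMr// xz.
  apply: (@le_trans _ _ l); first by rewrite ler_piMr// ltW.
  have t2 : 0 <= t ^+ 2 by exact: sqr_ge0.
  by move: t2 tw; generalize (t ^+ 2) => a *; nra.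
split; first exact: sphere_normalize.
split; first by rewrite /normalize dotvZl ze mulr_ge0 ?invr_ge0 ?ltW.
move=> u ue; rewrite /normalize !dotvZl mulrCA -mulrA ler_pM2l ?invr_gt0// ze.
have -> : dotv z u = l * dotv x u.
  by rewrite /z xE !dotvE (dotvC e) ue !mulr0 !add0r.
rewrite -(ler_pM2r c'0); apply: (@le_trans _ _ (t * (l * W' u * c))); last first.
  by rewrite -[leRHS]mulrA ler_pM2l// WW.
rewrite [leLHS](_ : _ = (l * c) * (c' * dotv x u)); last by ring.
rewrite [leRHS](_ : _ = (l * c) * (t * W' u)); last by ring.
by rewrite ler_pM2l ?mulr_gt0// xW.
Qed.

End hausdorff.

(** With h the tolerance, the errors cost h (l a + b) or h (l b + a) in the cross products, at most
    2 h = (1 - l) r^2 <= (1 - l) a b. Positivity of a' comes from h < r. *)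
Lemma ratio_close (R : realFieldType) (l r b a b' a' : R) :
  0 < l < 1 -> 0 < r -> r <= b <= 1 -> r <= a <= 1 ->
  `|b' - b| <= (1 - l) * r ^+ 2 / 2 -> `|a' - a| <= (1 - l) * r ^+ 2 / 2 ->
  [/\ 0 < a', l * b' * a <= b * a' & l * b * a' <= b' * a].
Proof.
move=> /andP[l0 l1] r0 /andP[rb b1] /andP[ra a1].
set h := (1 - l) * r ^+ 2 / 2; rewrite !ler_norml => /andP[b'1 b'2] /andP[a'1 a'2].
have rab : r ^+ 2 <= b * a by rewrite expr2 ler_pM// ltW.
have hab : 2 * h <= (1 - l) * (b * a).
  by rewrite /h mulrC divfK ?pnatr_eq0// ler_wpM2l// subr_ge0 (ltW l1).
have h0 : 0 <= h by rewrite divr_ge0// mulr_ge0 ?sqr_ge0// subr_ge0 (ltW l1).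
have hr : 2 * h < 2 * r.
  rewrite /h mulrC divfK ?pnatr_eq0// expr2.
  have : r * r <= r * 1 by rewrite ler_pM2l// (le_trans ra).
  have : 0 < l * (r * r) by rewrite !mulr_gt0.
  by lra.
clearbody h; have b0 : 0 < b by rewrite (lt_le_trans r0).
have a0 : 0 < a by rewrite (lt_le_trans r0).
have small x y : 0 < x -> 0 < y -> x <= 1 -> y <= 1 -> h * (x * y) <= h.
  by move=> x0 y0 x1 y1; rewrite ler_piMr// mulr_ile1// ltW.
have hla := small _ _ l0 a0 (ltW l1) a1; have hlb := small _ _ l0 b0 (ltW l1) b1.
have hb := small _ _ b0 ltr01 b1 (lexx _); have ha := small _ _ a0 ltr01 a1 (lexx _).
have lb' : l * b' * a <= l * (b + h) * a by rewrite ler_pM2r// ler_pM2l//; lra.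
have ba' : b * (a - h) <= b * a' by rewrite ler_pM2l//; lra.
have lba' : l * b * a' <= l * b * (a + h) by rewrite ler_pM2l ?mulr_gt0//; lra.
have b'a : (b - h) * a <= b' * a by rewrite ler_pM2r//; lra.
by split; lra.
Qed.

(** * From close support functions to close bodies *)

Section convergence.
Context {R : realType} (n : nat).
Local Notation V := 'rV[R]_n.+1.
Local Notation sigma := (@spherical_measure R n).
Variables (K : set V) (e : V).
Hypotheses (mK : measurable K) (Ksph : K `<=` sphere n) (K0 : (0 < sigma K)%E).
Hypothesis e1 : sphere n e.

(* [W'] and [c'] are empirical estimates of [width K] and [width K e], up to
   the factor [N / sigma K]. *)
Lemma support_bodies_close (t : R) : 0 < t < 1 -> exists2 eta : R, 0 < eta &
  forall (W' : V -> R) (c' N : R), 0 < N ->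
    (forall a u, W' (a *: u) = `|a| * W' u) ->
    (forall u, sphere n u -> `|W' u / N - width K u / fine (sigma K)| <= eta) ->
    `|c' / N - width K e / fine (sigma K)| <= eta ->
    0 < c' /\
    (shausdorff (support_body e W' c') (support_body e (width K) (width K e)) <= t%:E)%E.
Proof.
move=> /andP[t0 t1].
have s0 := fine_spherical_measure_gt0 mK K0.
set s := fine (sigma K) in s0 *; set c := width K e.
have [d0 d00 dW] := width_lower mK Ksph K0.
have WZ := widthZ mK Ksph.
have c0 : 0 < c by apply: width_gt0 => //; exact: sphere_neq0.
have tpi2 : t < pi / 2 by rewrite (lt_le_trans t1)// pihalf_ge1.
have tpi : 0 <= t <= pi.
  by rewrite (ltW t0) (le_trans (ltW tpi2))// ler_pdivrMr// ler_peMr// ?pi_ge0// ler1n.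
have l0 : 0 < cos t.
  by apply: cos_gt0_pihalf; rewrite tpi2 andbT (lt_trans _ t0)// oppr_lt0 divr_gt0// pi_gt0.
have l1 : cos t < 1.
  by rewrite -cos0 ltr_cos ?in_itv//= lexx pi_ge0.
have d0s : 0 < d0 / s by rewrite divr_gt0.
(* The tolerance of [ratio_close] for l = cos t and the lower bound d0 / s. *)
exists ((1 - cos t) * (d0 / s) ^+ 2 / 2).
  by rewrite divr_gt0// mulr_gt0 ?subr_gt0// exprn_gt0.
move=> W' c' N N0 W'Z W'W c'c.
have unit_bound u : sphere n u -> d0 / s <= width K u / s <= 1.
  move=> u1; rewrite ler_pM2r ?invr_gt0// ler_pdivrMr// mul1r.
  have := dW u; rewrite u1 mulr1 => ->/=.
  have := widthD_le mK Ksph 0 u; rewrite add0r u1 mul1r.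
  by rewrite -[X in width K X + _](scale0r u) WZ normr0 mul0r add0r.
have cb := unit_bound _ e1.
have c'0 : 0 < c'.
  have [] := @ratio_close R (cos t) (d0 / s) (c / s) (c / s) (c' / N) (c' / N) => //.
    by rewrite l0 l1.
  by rewrite pmulr_lgt0 ?invr_gt0.
split => //.
(* By homogeneity unit vectors suffice; the factors N and s cancel in the cross products. *)
have close u : cos t * W' u * c <= width K u * c' /\ cos t * width K u * c' <= W' u * c.
  have [->|u0] := eqVneq u 0.
    rewrite -(scale0r e) W'Z WZ normr0 !mul0r !mulr0 !mul0r; split; exact: lexx.
  suff [H1 H2] : cos t * W' (normalize u) * c <= width K (normalize u) * c' /\
      cos t * width K (normalize u) * c' <= W' (normalize u) * c.
    have nu : 0 < enorm u by rewrite enorm_gt0.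
    rewrite -[u]normalizeK W'Z WZ gtr0_norm//.
    rewrite !(mulrCA (cos t)) -!mulrA !(ler_pM2l nu) !mulrA; split => //.
  move: (normalize u) (sphere_normalize u0) => v v1.
  have [_ H1 H2] := @ratio_close R (cos t) (d0 / s) (width K v / s) (c / s)
    (W' v / N) (c' / N) (introT andP (conj l0 l1)) d0s (unit_bound _ v1) cb (W'W _ v1) c'c.
  have sN : 0 < s * N by rewrite mulr_gt0.
  have clear_l x y : x / N * (y / s) * (s * N) = x * y by field; rewrite !gt_eqF.
  have clear_r x y : x / s * (y / N) * (s * N) = x * y by field; rewrite !gt_eqF.
  rewrite -(ler_pM2r sN) clear_r !(mulrA (cos t)) clear_l in H1.
  by rewrite -(ler_pM2r sN) clear_l !(mulrA (cos t)) clear_r in H2.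
have ll : 0 < cos t <= 1 by rewrite l0 ltW.
apply: shausdorff_le => // [x Gx|x Gx]; (split; first by case: Gx).
  exact: (support_body_near e1 c0 c'0 ll (fun u _ => (close u).1) Gx).
exact: (support_body_near e1 c'0 c0 ll (fun u _ => (close u).2) Gx).
Qed.

End convergence.

(** * Almost sure convergence *)

Unset Implicit Arguments.

Theorem theorem1 (R : realType) (n : nat) (n2 : (2 <= n)%N)
    (K : set 'rV[R]_n.+1) (e : 'rV[R]_n.+1)
    (K_body : convex_body K) (e_unit : sphere n e)
    (K_sym : centrally_symmetric K e)
    (d : measure_display) (Omega : measurableType d) (P : probability Omega R)
    (U : nat -> {RV P >-> 'rV[R]_n.+1})
    (U_unit : forall i w, sphere n (U i w))
    (U_indep : mutually_independent U)
    (U_unif : forall i, uniformly_distributed_in K (U i)) :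
  {ae P, forall w,
    (fun N => shausdorff (discrete_centroid_body e (fun i : 'I_N => U i w))
                         (centroid_body K e)) @ \oo --> 0%E}.
Proof.
have [[Ksph _] cK _ Kint] := K_body.
have mK := closed_measurable_rV cK.
have K0 := spherical_measure_gt0 mK Ksph Kint.
have n0 : (0 < n)%N by exact: leq_trans n2.
rewrite (centroid_bodyE n0 mK Ksph K0 e_unit K_sym).
apply: filterS (uniform_law mK Ksph K0 U_unit U_indep U_unif) => w Hw.
have near_le (t : R) : 0 < t < 1 -> \forall N \near \oo,
    (shausdorff (discrete_centroid_body e (fun i : 'I_N => U i w))
      (support_body e (width K) (width K e)) <= t%:E)%E.
  move=> t01; have [eta eta0 close] := support_bodies_close mK Ksph K0 e_unit t01.
  apply: filterS2 (nbhs_infty_gt 0) (Hw _ eta0) => N N0 HN.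
  have NR : 0 < N%:R :> R by rewrite ltr0n.
  (* For unit u the functions |u . x| and e . x are bounded by 1 and 1-Lipschitz on the sphere, so
     [HN] covers them all. *)
  have [] := close (fun v => \sum_(i < N) `|dotv (U i w) v|) (\sum_(i < N) dotv (U i w) e) N%:R NR.
  - move=> a u; rewrite mulr_sumr; apply: eq_bigr => i _.
    by rewrite dotvZr normrM.
  - move=> u u1; have := HN (fun x => `|dotv u x|) (measurable_norm_dotv u).
    rewrite /sample_mean /body_mean -/(width K u).
    under eq_bigr do rewrite dotvC.
    apply; first by move=> x x1; rewrite normr_id (le_trans (ler_dotv_sphere _ x1))// u1.
    move=> x y x1 y1; rewrite (le_trans (ler_dist_dist _ _))// -dotvBr.
    by rewrite (le_trans (ler_dotv _ _))// u1 mul1r.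
  - have := HN (dotv e) (measurable_dotv e).
    rewrite /sample_mean /body_mean -(width_center K_sym.2).
    under eq_bigr do rewrite dotvC.
    apply; first by move=> x x1; rewrite (le_trans (ler_dotv_sphere _ x1))// e_unit.
    by move=> x y x1 y1; rewrite -dotvBr (le_trans (ler_dotv _ _))// e_unit mul1r.
  (* For these N the total height is positive, as [discrete_centroid_bodyE] requires. *)
  by move=> T0; rewrite discrete_centroid_bodyE.
apply/fine_cvgP; split.
  have half : 0 < (2^-1 : R) < 1 by rewrite invr_gt0 ltr0n invf_lt1// ltr1n.
  apply: filterS (near_le _ half) => N HN.
  by rewrite ge0_fin_numE ?shausdorff_ge0// (le_lt_trans HN)// ltry.
apply/cvgrPdist_le => eps eps0.
(* [near_le] is available below 1 only. *)
have m01 : 0 < Num.min eps 2^-1 < 1.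
  by rewrite lt_min eps0 invr_gt0 ltr0n/= gt_min invf_lt1 ?ltr1n ?orbT.
apply: filterS (near_le _ m01) => N HN.
rewrite sub0r normrN ger0_norm ?fine_ge0 ?shausdorff_ge0//.
rewrite -lee_fin fineK ?ge0_fin_numE ?shausdorff_ge0//.
  by rewrite (le_trans HN)// lee_fin ge_min lexx.
by rewrite (le_lt_trans HN)// ltry.
Qed.
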